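(* Let $R=\mathbb{Z}$ or $R=\mathbb{F}_p$ ($p$ a prime), let $X$ be a set, and let $\mathsf{T}_R(X)$ be the free binomial $\cup_1$-graded algebra over $R$ on $X$. Let $d\colon \mathsf{T}_R(X)\to \mathsf{T}_R(X)$ be an $R$-linear map of degree one satisfying the $\cup_1$–$d$ formula $$d(a\cup_1 b)=-a\cup b-b\cup a+da\cup_1 b+db\cup_1 a-da\circ db\qquad (a,b\in \mathsf{T}^1_R(X))$$ and the graded Leibniz rule $d(u\cup v)=du\cup v+(-1)^{|u|}u\cup dv$. Then $d^2(x)=0$ for all $x\in X$ if and only if $d^2(u)=0$ for all $u\in \mathsf{T}_R(X)$, in which case $(\mathsf{T}_R(X),d)$ is a binomial cup-one dga.
   Context: Free binomial algebra. For a set $X$, $\mathrm{Int}(\mathbb{Z}^X)=\{q\in\mathbb{Q}[X] : q(\mathbb{Z}^X)\subseteq\mathbb{Z}\}$, and $\mathrm{Int}(\mathbb{F}_p^X)$ is the quotient of $\mathrm{Int}(\mathbb{Z}^X)$ by the ideal generated by the elements $\zeta_n(x)=\binom{x}{n}$ ($x\in X$, $n\ge p$), tensored with $\mathbb{F}_p$. Let $\mathfrak{m}_{X,R}\subset \mathrm{Int}(R^X)$ be the $R$-submodule of polynomials with zero constant term. The free binomial $\cup_1$-graded algebra is the tensor algebra $\mathsf{T}_R(X)=T^*(\mathfrak{m}_{X,R})$ over $R$, so $\mathsf{T}^0=R$, $\mathsf{T}^1=\mathfrak{m}_{X,R}\supset X$; its product is written $\cup$ (equal to $\otimes$). It carries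 the $R$-linear maps $\cup_1\colon \mathsf{T}^1\otimes \mathsf{T}^1\to \mathsf{T}^1$, $a\cup_1 b=ab$ (product in $\mathrm{Int}(R^X)$); $\cup_1\colon \mathsf{T}^2\otimes \mathsf{T}^1\to \mathsf{T}^2$, $(a\otimes b)\cup_1 c=ac\otimes b+a\otimes bc$; and $\circ\colon \mathsf{T}^2\otimes \mathsf{T}^2\to \mathsf{T}^2$, $(a_1\otimes a_2)\circ(b_1\otimes b_2)=a_1b_1\otimes a_2b_2$. Binomial cup-one dga. A dga over $R$ is a graded $R$-algebra $A=\bigoplus_{i\ge0}A^i$ (product $\cup$) with a degree-one map $d$, $d^2=0$, satisfying the graded Leibniz rule. $D^2(A)\subset A^2$ is the $R$-span of all $a\cup b$, $a,b\in A^1$. A cup-one dga is a dga with $R$-linear maps $\cup_1\colon A^1\otimes_R A^1\to A^1$, $\cup_1\colon D^2(A)\otimes_R A^1\to A^2$, $\circ\colon D^2(A)\otimes_R D^2(A)\to D^2(A)$ such that: (i) $R\oplus A^1$, with multiplication given by that of $R$, scalar multiplication, and $\cup_1$ on $A^1$, is a commutative $R$-algebra with identity $1\in R$; (ii) $(a\cup b)\cup_1 c=a\cup(b\cup_1 c)+(a\cup_1 c)\cup b$ for $a,b,c\in A^1$; (iii) $(u\cup v)\circ(w\cup z)=(u\cup_1 w)\cup(v\cup_1 z)$ for $u,v,w,z\in A^1$; (iv) $a\cup_1 dc=a\cup c-c\cup a$ for $a\in A^1$, $c\in A^0$; (v) the $\cup_1$–$d$ formula above holds for all $a,b\in A^1$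 with $da,db\in D^2(A)$. An $R$-binomial algebra is: for $R=\mathbb{Z}$, a commutative ring, torsion-free as abelian group, in which $\binom{a}{n}=a(a-1)\cdots(a-n+1)/n!$ lies in the ring for all $a$ and $n>0$; for $R=\mathbb{F}_p$, a commutative $\mathbb{F}_p$-algebra with $a(a-1)\cdots(a-p+1)=0$ (equivalently $a^p=a$) for all $a$. A binomial cup-one dga is a cup-one dga such that $A^0$ (under $\cup$) and $R\oplus A^1$ (under $\cup_1$) are $R$-binomial algebras. *)

(* Defs.v *)
From HB Require Import structures.
From mathcomp Require Import all_boot all_order all_algebra finfield.
From mathcomp Require Import finmap boolp xfinmap monalg ring.

Set Implicit Arguments.
Unset Strict Implicit.
Unset Printing Implicit Defensive.

Import GRing.Theory Num.Theory.
Local Open Scope ring_scope.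
Local Open Scope quotient_scope.

Local Notation "1" := (@mone _) : monom_scope.
Local Notation "x * y" := (mmul x y) : monom_scope.

Section GeneratedIdeal.
Variables (A : nzRingType) (G : A -> Prop).

Definition two_sided_ideal (J : A -> Prop) : Prop :=
  [/\ J 0, forall x y, J x -> J y -> J (x - y) &
      forall u x v, J x -> J (u * x * v)].

Definition gen_ideal (x : A) : Prop :=
  forall J, two_sided_ideal J -> (forall g, G g -> J g) -> J x.

Lemma gen_ideal_two_sided : two_sided_ideal gen_ideal.
Proof.
split=> [J [] //|x y hx hy J hJ GJ|u x v hx J hJ GJ].
  by case: (hJ) => _ h _; apply: h; [apply: hx|apply: hy].
by case: (hJ) => _ _ h; apply: h; apply: hx.
Qed.

Definition gen_idealb : A -> bool := fun x => `[< gen_ideal x >].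

Lemma gen_idealb_zmod_closed : zmod_closed gen_idealb.
Proof.
have [h0 hB _] := gen_ideal_two_sided.
by split=> [|x y /asboolP hx /asboolP hy]; apply/asboolP; [|apply: hB].
Qed.

HB.instance Definition _ :=
  GRing.isZmodClosed.Build A gen_idealb gen_idealb_zmod_closed.

Definition gen_idealz : zmodClosed A := GRing.ZmodClosed.clone A gen_idealb _.

Lemma kernel_core_two_sided (V : zmodType) (f : {additive A -> V}) :
  two_sided_ideal (fun y => forall u v : A, f (u * y * v) = 0).
Proof.
split=> [u v|x y hx hy u v|a x b hx u v].
- by rewrite mulr0 mul0r raddf0.
- by rewrite mulrBr mulrBl raddfB hx hy subrr.
- by rewrite !mulrA -[_ * b * v]mulrA hx.
Qed.

Lemma gen_ideal_gen g : G g -> gen_ideal g.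
Proof. by move=> Gg J _; apply. Qed.

(* Properness is recorded in the type because [nzRingType] is non-trivial. *)
Definition ring_quot of ~ gen_ideal 1 : Type := Quotient.quot gen_idealz.

End GeneratedIdeal.

Section RingQuotient.
Variables (A : nzRingType) (G : A -> Prop) (ntG : ~ gen_ideal G 1).
Local Notation Q := (ring_quot ntG).

HB.instance Definition _ := GRing.Zmodule.on Q.

(* Locked, so that unification does not unfold the product of a quotient. *)
Fact rproj_key : unit. Proof. by []. Qed.
Definition rproj : A -> Q :=
  locked_with rproj_key (fun x => \pi_(Quotient.quot (gen_idealz G)) x).
Definition rrepr : Q -> A :=
  locked_with rproj_key (fun x => repr (x : Quotient.quot (gen_idealz G))).

Lemma rreprK : cancel rrepr rproj.
Proof. by move=> x; rewrite /rproj /rrepr !locked_withE; apply: reprK. Qed.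

Lemma rproj_eq x y : rproj x = rproj y <-> gen_ideal G (x - y).
Proof.
rewrite /rproj locked_withE; split=> [/eqP|h].
  by rewrite -Quotient.idealrBE => /asboolP.
by apply/eqP; rewrite -Quotient.idealrBE; apply/asboolP.
Qed.

Lemma rprojB : zmod_morphism rproj.
Proof. by move=> x y; rewrite /rproj locked_withE raddfB. Qed.

HB.instance Definition _ := GRing.isZmodMorphism.Build A Q rproj rprojB.

Definition rq_one : Q := rproj 1.
Definition rq_mul (x y : Q) : Q := rproj (rrepr x * rrepr y).

Lemma rrepr_proj x : gen_ideal G (rrepr (rproj x) - x).
Proof. by apply/rproj_eq; rewrite rreprK. Qed.

Lemma rq_mulE x y : rq_mul (rproj x) (rproj y) = rproj (x * y).
Proof.
apply/rproj_eq; have [h0 hB hM] := gen_ideal_two_sided G.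
rewrite (_ : _ - _ = 1 * (rrepr (rproj x) - x) * rrepr (rproj y)
  - (x * (y - rrepr (rproj y)) * 1)).
  apply: (hB); apply: hM; first exact: rrepr_proj.
  by rewrite -opprB -[- _]add0r; apply: hB => //; apply: rrepr_proj.
by rewrite mul1r mulr1 mulrBl mulrBr opprB addrA subrK.
Qed.

Lemma rq_ind (P : Q -> Prop) : (forall x, P (rproj x)) -> forall x, P x.
Proof. by move=> h x; rewrite -[x]rreprK. Qed.

Lemma rq_mulA : associative rq_mul.
Proof.
by elim/rq_ind=> x; elim/rq_ind=> y; elim/rq_ind=> z; rewrite !rq_mulE mulrA.
Qed.
Lemma rq_mul1r : left_id rq_one rq_mul.
Proof. by elim/rq_ind=> x; rewrite rq_mulE mul1r. Qed.
Lemma rq_mulr1 : right_id rq_one rq_mul.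
Proof. by elim/rq_ind=> x; rewrite rq_mulE mulr1. Qed.
Lemma rq_mulDl : left_distributive rq_mul +%R.
Proof.
elim/rq_ind=> x; elim/rq_ind=> y; elim/rq_ind=> z.
by rewrite -raddfD !rq_mulE mulrDl raddfD.
Qed.
Lemma rq_mulDr : right_distributive rq_mul +%R.
Proof.
elim/rq_ind=> x; elim/rq_ind=> y; elim/rq_ind=> z.
by rewrite -raddfD !rq_mulE mulrDr raddfD.
Qed.
Lemma rq_one_neq0 : rq_one != 0.
Proof.
apply/eqP; rewrite -(raddf0 rproj) => /rproj_eq; rewrite subr0; exact: ntG.
Qed.

HB.instance Definition _ := GRing.Zmodule_isNzRing.Build Q
  rq_mulA rq_mul1r rq_mulr1 rq_mulDl rq_mulDr rq_one_neq0.

Lemma rproj_monoid_morphism : monoid_morphism rproj.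
Proof. by split=> // x y; rewrite -rq_mulE. Qed.

HB.instance Definition _ :=
  GRing.isMonoidMorphism.Build A Q rproj rproj_monoid_morphism.

End RingQuotient.

Section ComRingQuotient.
Variables (A : comNzRingType) (G : A -> Prop) (ntG : ~ gen_ideal G 1).

Lemma rq_mulC : @commutative (ring_quot ntG) _ *%R.
Proof. by elim/rq_ind=> x; elim/rq_ind=> y; rewrite -!rmorphM mulrC. Qed.

HB.instance Definition _ :=
  GRing.PzRing_hasCommutativeMul.Build (ring_quot ntG) rq_mulC.

End ComRingQuotient.

Section LalgQuotient.
Variables (R : comNzRingType) (A : lalgType R) (G : A -> Prop).
Variable ntG : ~ gen_ideal G 1.
Local Notation Q := (ring_quot ntG).

Definition rq_scale (c : R) (x : Q) : Q := rproj ntG (c *: rrepr x).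

Lemma rq_scaleE c x : rq_scale c (rproj ntG x) = rproj ntG (c *: x).
Proof.
apply/rproj_eq; have [_ _ hM] := gen_ideal_two_sided G.
rewrite -scalerBr -[X in c *: X]mul1r scalerAl -[X in gen_ideal _ X]mulr1.
by apply: hM; apply: rrepr_proj.
Qed.

Lemma rq_scaleA a b x : rq_scale a (rq_scale b x) = rq_scale (a * b) x.
Proof. by elim/rq_ind: x => x; rewrite !rq_scaleE scalerA. Qed.
Lemma rq_scale1 : left_id 1 rq_scale.
Proof. by elim/rq_ind=> x; rewrite rq_scaleE scale1r. Qed.
Lemma rq_scaleDr : right_distributive rq_scale +%R.
Proof.
move=> c; elim/rq_ind=> x; elim/rq_ind=> y.
by rewrite -raddfD !rq_scaleE scalerDr raddfD.
Qed.
Lemma rq_scaleDl x : {morph rq_scale^~ x : a b / a + b}.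
Proof. by move=> a b; elim/rq_ind: x => x; rewrite !rq_scaleE scalerDl raddfD. Qed.

HB.instance Definition _ := GRing.Zmodule_isLmodule.Build R Q
  rq_scaleA rq_scale1 rq_scaleDr rq_scaleDl.

Lemma rproj_scalable : scalable (rproj ntG).
Proof. by move=> c x; apply: (esym (rq_scaleE c x)). Qed.

Lemma rq_scaleAl (c : R) (x y : Q) : c *: (x * y) = c *: x * y.
Proof.
elim/rq_ind: x => x; elim/rq_ind: y => y; have scE := rproj_scalable.
by rewrite -rmorphM -!scE -rmorphM scalerAl.
Qed.

HB.instance Definition _ := GRing.Lmodule_isLalgebra.Build R Q rq_scaleAl.

HB.instance Definition _ := 
  GRing.isScalable.Build R A Q _ (rproj ntG) rproj_scalable.

End LalgQuotient.

Definition linear_rel (R : comNzRingType) (M : lmodType R) (F : lalgType R)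
    (L : M -> F) (r : F) : Prop :=
  exists (c : R) (a b : M), r = L (c *: a + b) - (c *: L a + L b).

Lemma linear_rel_ker (R : comNzRingType) (M : lmodType R) (F : lalgType R)
    (L : M -> F) (V : lmodType R) (f : {linear F -> V}) (S : F -> F -> M -> V) :
  (forall (c : R) (x y : F), c *: (x * y) = x * (c *: y)) ->
  (forall u v z, f (u * L z * v) = S u v z) ->
  (forall u v, linear (S u v)) ->
  forall x, gen_ideal (linear_rel L) x -> f x = 0.
Proof.
move=> scAr fS Slin x /(_ _ (kernel_core_two_sided f)) h.
rewrite -[x]mul1r -[_ * x]mulr1; apply: h => _ [c [a [b ->]]] u v.
rewrite mulrBr mulrDr -scAr mulrBl mulrDl -scalerAl.
by apply: etrans (linearB f _ _) _; rewrite linearP !fS Slin subrr.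
Qed.

Lemma sandwich_sum (A : nzRingType) (I J : Type) (r : seq I) (s : seq J)
    (F : I -> A) (H : J -> A) (x : A) :
  (\sum_(i <- r) F i) * x * (\sum_(j <- s) H j) =
  \sum_(i <- r) \sum_(j <- s) F i * x * H j.
Proof.
rewrite mulr_suml mulr_suml; apply: eq_bigr => i _.
by rewrite mulr_sumr.
Qed.

Section TensorAlgebra.
Variables (R : comNzRingType) (M : lmodType R).

Local Notation free_alg := {malg R[{fmonom M}]}.

Definition letter (a : M) : free_alg := << fmu a >>.

Definition tensor_rel : free_alg -> Prop := linear_rel letter.

Lemma tensor_rel_proper : ~ gen_ideal tensor_rel 1.
Proof.
move=> /(_ (fun x : free_alg => x@_1%M = 0)) h; suff: (1 : R) = 0 by apply/eqP/oner_neq0.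
rewrite -(mcoeff1g_is_multiplicative {fmonom M} R).2; apply: h.
- split=> [|x y hx hy|u x v hx]; first by rewrite mcoeff0.
    by rewrite mcoeffB hx hy subrr.
  by rewrite !rmorphM /= hx mulr0 mul0r.
- move=> _ [c [a [b ->]]]; rewrite mcoeffB mcoeffD mcoeffZ /letter !mcoeffU1.
  by rewrite -!fdeg_eq0 !fdegU mulr0 addr0 subr0.
Qed.

Definition tensor_alg : Type := ring_quot tensor_rel_proper.
HB.instance Definition _ := GRing.Lalgebra.on tensor_alg.

Lemma free_alg_scaleAr (c : R) (x y : free_alg) : c *: (x * y) = x * (c *: y).
Proof.
have scE (z : free_alg) : c *: z = c%:MP * z by apply/esym/mul_malgC.
rewrite (scE (x * y)) (scE y) 2!mulrA.
suff -> : c%:MP * x = x * c%:MP :> free_alg by [].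
rewrite {1 2}[x]monalgE mulr_sumr mulr_suml; apply: eq_bigr => k _.
by rewrite 2!malgM_def 2!fgmulUU mulrC mul1m mulm1.
Qed.

Lemma tensor_alg_scaleAr (c : R) (x y : tensor_alg) :
  c *: (x * y) = x * (c *: y).
Proof.
elim/rq_ind: x => x; elim/rq_ind: y => y.
by rewrite -rmorphM -!linearZ /= -rmorphM free_alg_scaleAr.
Qed.

HB.instance Definition _ :=
  GRing.Lalgebra_isAlgebra.Build R tensor_alg tensor_alg_scaleAr.

Definition tpi : free_alg -> tensor_alg := rproj tensor_rel_proper.
HB.instance Definition _ := GRing.Linear.on tpi.
HB.instance Definition _ := GRing.RMorphism.on tpi.

Fact tin_key : unit. Proof. by []. Qed.
Definition tin : M -> tensor_alg := locked_with tin_key (fun a => tpi (letter a)).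

Lemma tinE a : tin a = tpi (letter a).
Proof. by rewrite /tin locked_withE. Qed.

Lemma tin_linear : linear tin.
Proof.
move=> c a b; rewrite !tinE -linearZ -raddfD; apply/rproj_eq.
by apply: gen_ideal_gen; exists c, a, b.
Qed.

HB.instance Definition _ := GRing.isLinear.Build R M tensor_alg _ tin tin_linear.

Definition tword (w : seq M) : tensor_alg := \prod_(a <- w) tin a.

Definition multilinear (V : lmodType R) (g : seq M -> V) : Prop :=
  forall w w' (c : R) (a b : M),
    g (w ++ (c *: a + b) :: w') = c *: g (w ++ a :: w') + g (w ++ b :: w').

Definition flift (V : lmodType R) (g : seq M -> V) (x : free_alg) : V :=
  \sum_(k <- msupp x) x@_k *: g (fmonom_val k).

(* The linear map sending a_1 (x) ... (x) a_n to g [:: a_1; ...; a_n]; only    *)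
(* meaningful for multilinear g, see [tlift_linear] and [tliftE].             *)
Definition tlift (V : lmodType R) (g : seq M -> V) (t : tensor_alg) : V :=
  flift g (rrepr (t : ring_quot tensor_rel_proper)).

Section Lift.
Variables (V : lmodType R) (g : seq M -> V).

Lemma fliftEw (E : {fset {fmonom M}}) x : (msupp x `<=` E)%fset ->
  flift g x = \sum_(k <- E) x@_k *: g (fmonom_val k).
Proof.
move=> le; rewrite [LHS](big_fset_incl _ le) => //= k _ /mcoeff_outdom ->.
by rewrite scale0r.
Qed.

Lemma flift_linear : linear (flift g).
Proof.
move=> c x y; pose E := (msupp x `|` msupp y `|` msupp (c *: x + y))%fset.
rewrite (@fliftEw E) ?fsubsetUr // (@fliftEw E x); last first.
  by rewrite /E -fsetUA fsubsetUl.
rewrite (@fliftEw E y); last by rewrite /E [(msupp x `|` _)%fset]fsetUC -fsetUA fsubsetUl.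
rewrite scaler_sumr -big_split /=; apply: eq_bigr => k _.
by rewrite mcoeffD mcoeffZ scalerDl scalerA.
Qed.

HB.instance Definition _ :=
  GRing.isLinear.Build R free_alg V _ (flift g) flift_linear.

Lemma fliftU k : flift g << k >> = g (fmonom_val k).
Proof. by rewrite (fliftEw msuppU_le) big_seq_fset1 mcoeffUU scale1r. Qed.

Lemma fliftB x y : flift g (x - y) = flift g x - flift g y.
Proof. exact: raddfB. Qed.

Lemma fliftM (u v : free_alg) z : flift g (u * letter z * v) =
  \sum_(k <- msupp u) \sum_(l <- msupp v)
    (u@_k * v@_l) *: g (fmonom_val k ++ z :: fmonom_val l).
Proof.
have := sandwich_sum (msupp u) (msupp v) (fun k => << u@_k *g k >>)
  (fun l => << v@_l *g l >>) (letter z).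
rewrite -!monalgE => ->; rewrite linear_sum; apply: eq_bigr => k _ /=.
rewrite linear_sum; apply: eq_bigr => l _ /=.
have -> : << u@_k *g k >> * letter z * << v@_l *g l >> =
    << u@_k * v@_l *g (k * fmu z * l)%M >> :> free_alg.
  by rewrite /letter !malgM_def !fgmulUU mulr1.
rewrite (fliftEw msuppU_le) big_seq_fset1 mcoeffUU.
by rewrite !fmM fmU -catA.
Qed.

Hypothesis gM : multilinear g.

Lemma flift_ideal x : gen_ideal tensor_rel x -> flift g x = 0.
Proof.
apply: (@linear_rel_ker R M free_alg letter V (flift g) _
  free_alg_scaleAr fliftM) => u v c a b.
rewrite scaler_sumr -big_split; apply: eq_bigr => k _ /=.
rewrite scaler_sumr -big_split; apply: eq_bigr => l _ /=.
by rewrite gM scalerDr !scalerA [c * _]mulrC.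
Qed.

Lemma tlift_pi x : tlift g (tpi x) = flift g x.
Proof.
by apply/eqP; rewrite -subr_eq0 -fliftB flift_ideal //; apply: rrepr_proj.
Qed.

Lemma tlift_linear : linear (tlift g).
Proof.
move=> c; elim/rq_ind=> x; elim/rq_ind=> y.
by rewrite -[rproj _ x]/(tpi x) -[rproj _ y]/(tpi y) -linearP !tlift_pi linearP.
Qed.

Lemma tliftE w : tlift g (tword w) = g w.
Proof.
have -> : tword w = tpi << FMonom w >>.
  elim: w => [|a w IH]; first by rewrite /tword big_nil -fmoneE -(rmorph1 tpi).
  rewrite /tword big_cons -/(tword w) {}IH tinE /letter -rmorphM; congr tpi.
  rewrite malgM_def fgmulUU mulr1; congr (<< _ >>).
  by apply/eqP; rewrite fmP fmM fmU.
by rewrite tlift_pi fliftU.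
Qed.

End Lift.

End TensorAlgebra.

Section IntegerValued.
Variable X : choiceType.

Local Notation polyQ := {malg rat[{cmonom X}]}.

Definition monom_eval (f : X -> int) (m : {cmonom X}) : rat :=
  \prod_(x <- finsupp m) (f x)%:~R ^+ m x.

Lemma monom_eval_mmorphism f : mmorphism (monom_eval f).
Proof.
have evalEw (m : {cmonom X}) (E : {fset X}) : (finsupp m `<=` E)%fset ->
    monom_eval f m = \prod_(x <- E) (f x)%:~R ^+ m x.
  move=> le; rewrite [LHS](big_fset_incl _ le) => //= x _.
  by rewrite memNfinsupp => /eqP ->.
split=> [m1 m2|]; last by rewrite /monom_eval mdom1 big_seq_fset0.
rewrite (evalEw m1 (finsupp m1 `|` finsupp m2)%fset) ?fsubsetUl //.
rewrite (evalEw m2 (finsupp m1 `|` finsupp m2)%fset) ?fsubsetUr //.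
rewrite /monom_eval mdomD -big_split; apply: eq_bigr => x _ /=.
by rewrite cmM exprD.
Qed.

HB.instance Definition _ f :=
  isMultiplicative.Build {cmonom X} rat (monom_eval f) (monom_eval_mmorphism f).

Definition peval (f : X -> int) : polyQ -> rat := mmap idfun (monom_eval f).

HB.instance Definition _ f := GRing.RMorphism.on (peval f).

Definition int_valued : polyQ -> bool :=
  fun q => `[< forall f : X -> int, peval f q \is a Num.int >].

Lemma int_valued_subring : subring_closed int_valued.
Proof.
split=> [|q r /asboolP hq /asboolP hr|q r /asboolP hq /asboolP hr];
  apply/asboolP => f.
- by rewrite rmorph1 rpred1.
- by rewrite rmorphB rpredB ?hq ?hr.
- by rewrite rmorphM rpredM ?hq ?hr.
Qed.

HB.instance Definition _ :=
  GRing.isSubringClosed.Build polyQ int_valued int_valued_subring.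

Record IntZ := MkIntZ { intz_val :> polyQ; _ : intz_val \in int_valued }.

HB.instance Definition _ := [isSub for intz_val].
HB.instance Definition _ := [Choice of IntZ by <:].
HB.instance Definition _ := [SubChoice_isSubComNzRing of IntZ by <:].

Definition intz_scale (n : int) (q : IntZ) : IntZ := q *~ n.

Lemma intz_scaleA a b q : intz_scale a (intz_scale b q) = intz_scale (a * b) q.
Proof. by rewrite /intz_scale -mulrzA mulrC. Qed.
Lemma intz_scale1 : left_id 1 intz_scale.
Proof. by move=> q; apply: mulr1z. Qed.
Lemma intz_scaleDr : right_distributive intz_scale +%R.
Proof. by move=> n q r; apply: mulrzDl. Qed.
Lemma intz_scaleDl q : {morph intz_scale^~ q : a b / a + b}.
Proof. by move=> a b; apply: mulrzDr. Qed.

HB.instance Definition _ := GRing.Zmodule_isLmodule.Build int IntZ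
  intz_scaleA intz_scale1 intz_scaleDr intz_scaleDl.

Lemma intz_scaleAl (n : int) (q r : IntZ) : n *: (q * r) = n *: q * r.
Proof. by rewrite -[LHS]/((q * r) *~ n) -[n *: q]/(q *~ n) mulrzAl. Qed.

HB.instance Definition _ := GRing.Lmodule_isLalgebra.Build int IntZ intz_scaleAl.
HB.instance Definition _ := GRing.Lalgebra_isComAlgebra.Build int IntZ.

Definition pvar (x : X) : polyQ := << ucm x >>.

Lemma peval_var f x : peval f (pvar x) = (f x)%:~R.
Proof.
rewrite /peval /pvar mmapU mul1r /monom_eval mdomU big_seq_fset1.
by rewrite cmUU expr1.
Qed.

Lemma pvar_int x : pvar x \in int_valued.
Proof. by apply/asboolP => f; rewrite peval_var intr_int. Qed.

Definition varZ (x : X) : IntZ := MkIntZ (pvar_int x).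

Definition pzeta (n : nat) (x : X) : polyQ :=
  n`!%:R^-1 *: \prod_(i < n) (pvar x - i%:R).

Lemma int_ffact_dvd (z : int) n :
  exists k : int, \prod_(i < n) (z - i%:R) = k * n`!%:R.
Proof.
case: z => k.
  exists 'C(k, n)%:R; rewrite -natrM bin_ffact ffact_prod natr_prod.
  have [le_nk|lt_kn] := leqP n k.
    by apply: eq_bigr => i _; rewrite natrB ?natz // ltnW // (leq_trans _ le_nk).
  rewrite (bigD1 (Ordinal lt_kn)) //= natz subrr mul0r.
  by rewrite (bigD1 (Ordinal lt_kn)) //= subnn mul0r.
exists ((-1) ^+ n * 'C(k + n, n)%:R).
rewrite -mulrA -natrM bin_ffact NegzE; elim: n => [|n IH].
  by rewrite big_ord0 ffactn0 mulr1.
rewrite big_ord_recr /= IH addnS ffactSS natrM exprS.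
have -> : - k.+1%:Z - n%:R = - (k + n).+1%:R :> int.
  by rewrite natz -opprD -PoszD addSn natz.
by move: ((-1) ^+ n) (_ ^_ n)%:R => x y; ring.
Qed.

Lemma pzeta_int n x : pzeta n x \in int_valued.
Proof.
apply/asboolP => f; rewrite /pzeta /peval mmapZ -/(peval f _) rmorph_prod /=.
have -> : \prod_(i < n) peval f (pvar x - i%:R) =
    (\prod_(i < n) (f x - i%:R))%:~R.
  rewrite rmorph_prod; apply: eq_bigr => i _.
  by rewrite rmorphB rmorph_nat /= peval_var rmorphB /= rmorph_nat.
have [k ->] := int_ffact_dvd (f x) n.
rewrite rmorphM /= rmorph_nat mulrCA mulVf ?mulr1 ?intr_int //.
by rewrite pnatr_eq0 -lt0n fact_gt0.
Qed.

Definition zeta (n : nat) (x : X) : IntZ := MkIntZ (pzeta_int n x).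

Lemma const_int (q : IntZ) : (q : polyQ)@_1%M \is a Num.int.
Proof.
case: q => q /= /asboolP /(_ (fun=> 0)); congr (_ \is a _).
rewrite /peval mmapE [RHS](_ : _ = \sum_(k <- msupp q) q@_k *+ (k == 1%M)).
  apply: eq_bigr => k _ /=; rewrite /monom_eval; have [->|] := eqVneq k 1%M.
    by rewrite mdom1 big_seq_fset0 mulr1.
  rewrite -mdeg_eq0 => hk; have /fset0Pn[x xk] : finsupp k != fset0.
    by apply: contraNneq hk => h; rewrite mdegE h big_seq_fset0.
  rewrite (big_fsetD1 x) //= expr0n; move: xk; rewrite -cmE_neq0 => /negPf ->.
  by rewrite mul0r mulr0 mulr0n.
rewrite {1}[q]monalgE raddf_sum; apply: eq_bigr => k _ /=.
by rewrite mcoeffU.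
Qed.

End IntegerValued.

Section IntegerValuedMod.
Variables (p : nat) (p_pr : prime p) (X : choiceType).

(* Dividing by p as well as by the zeta_n(x) is tensoring the quotient by the *)
(* latter with F_p.                                                           *)
Definition zeta_rel (q : IntZ X) : Prop :=
  q = p%:R \/ exists (x : X) (n : nat), (p <= n)%N /\ q = zeta n x.

Lemma zeta_rel_proper : ~ gen_ideal zeta_rel 1.
Proof.
pose ct (q : IntZ X) : rat := (intz_val q)@_1%M.
move=> /(_ (fun q => exists k : int, ct q = (k * p%:R)%:~R)) [].
- split=> [|q r [k hk] [l hl]|u q v [k hk]].
  + by exists 0; rewrite /ct /= mcoeff0 mul0r.
  + by exists (k - l); rewrite /ct /= mcoeffB -!/(ct _) hk hl mulrBl rmorphB.
  + have /intrP[a ha] := const_int u; have /intrP[b hb] := const_int v.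
    exists (a * k * b); rewrite /ct /= !rmorphM /= ha hb -/(ct q) hk.
    by rewrite -!intrM; congr (_%:~R); ring.
- move=> q [->|[x [n [le_pn ->]]]].
    exists 1; rewrite /ct mul1r rmorph_nat.
    have vE n : intz_val (n%:R : IntZ X) = n%:R :> {malg rat[{cmonom X}]}.
      exact: (rmorph_nat (\val : IntZ X -> {malg rat[{cmonom X}]}) n).
    rewrite vE.
    by rewrite rmorph_nat.
  exists 0; rewrite mul0r /ct /= /pzeta mcoeffZ rmorph_prod /=.
  have n_gt0 : (0 < n)%N by apply: leq_trans le_pn; apply: prime_gt0.
  rewrite (bigD1 (Ordinal n_gt0)) //= subr0 mcoeffU1.
  by rewrite cm1_eq1 mul0r mulr0.
move=> k; rewrite /ct /= mcoeff1 eqxx => /eqP.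
rewrite -(rmorph1 (intr : int -> rat)) eqr_int => /eqP.
move/(congr1 absz); rewrite abszM natz absz_nat => h.
have : (p %| 1)%N by rewrite -[1%N]/`|1|%N h dvdn_mull.
by rewrite dvdn1 => /eqP p1; move: (p_pr); rewrite p1.
Qed.

Lemma zeta_quot_pchar : p \in [pchar ring_quot zeta_rel_proper].
Proof.
rewrite inE p_pr /= -(rmorph_nat (rproj zeta_rel_proper)).
rewrite -(rmorph0 (rproj zeta_rel_proper)); apply/eqP/rproj_eq.
by rewrite subr0; apply: gen_ideal_gen; left.
Qed.

Definition IntFp : Type := pPrimeCharType zeta_quot_pchar.
HB.instance Definition _ := GRing.ComAlgebra.on IntFp.

Definition projFp (q : IntZ X) : IntFp := rproj zeta_rel_proper q.

End IntegerValuedMod.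

Definition lspan (R : pzRingType) (V : lmodType R) (P : V -> Prop) (v : V) : Prop :=
  exists s : seq (R * V),
    (forall cw, cw \in s -> P cw.2) /\ v = \sum_(cw <- s) cw.1 *: cw.2.

Section TensorCup.
Variables (R : comNzRingType) (M : lmodType R) (mu : M -> M -> M).
Local Notation T := (tensor_alg M).

Definition tgrade (n : nat) : T -> Prop :=
  lspan (fun t => exists w : n.-tuple M, t = tword w).

Definition tproj1 : T -> M := tlift (fun w => if w is [:: a] then a else 0).

(* The cup-one operations are total functions on the tensor algebra; only     *)
(* their restrictions to the components named in [tcup11E], [tcup21E] and     *)
(* [tcircE] are used.                                                         *)
Definition tcup11 (s t : T) : T := tin (mu (tproj1 s) (tproj1 t)).

Definition tcup21 (s t : T) : T :=
  let c := tproj1 t in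
  tlift (fun w => if w is [:: a; b]
                  then tin (mu a c) * tin b + tin a * tin (mu b c) else 0) s.

Definition tcirc (s t : T) : T :=
  tlift (fun w => if w is [:: a1; a2] then
    tlift (fun w' => if w' is [:: b1; b2]
                     then tin (mu a1 b1) * tin (mu a2 b2) else 0) t
    else 0) s.

Hypothesis mu_l : forall b, linear (mu^~ b).
Hypothesis mu_r : forall a, linear (mu a).

Lemma multilinear1 (V : lmodType R) (f : M -> V) :
  linear f -> multilinear (fun w : seq M => if w is [:: a] then f a else 0).
Proof.
move=> fL [|x [|y w]] [|x' w'] c a b //=; rewrite ?scaler0 ?addr0 //.
exact: fL.
Qed.

Lemma multilinear2 (V : lmodType R) (f : M -> M -> V) :
  (forall b, linear (f^~ b)) -> (forall a, linear (f a)) ->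
  multilinear (fun w : seq M => if w is [:: a; b] then f a b else 0).
Proof.
move=> fl fr [|x [|y [|z w]]] [|x' [|y' w']] c a b //=;
  rewrite ?scaler0 ?addr0 //; [exact: fl|exact: fr].
Qed.

Lemma tproj1_linear : linear tproj1.
Proof. exact/tlift_linear/(@multilinear1 _ id). Qed.

Lemma tproj1E a : tproj1 (tin a) = a.
Proof.
have -> : tin a = tword [:: a] by rewrite /tword big_seq1.
by rewrite /tproj1 tliftE //; apply: (@multilinear1 _ id).
Qed.

Lemma tword2 (a b : M) : tin a * tin b = tword [:: a; b].
Proof. by rewrite /tword big_cons big_seq1. Qed.

Lemma mul2_linearl (f : M -> M) (b : T) :
  linear f -> linear (fun a => tin (f a) * b).
Proof. by move=> fL c x y; rewrite fL linearP mulrDl scalerAl. Qed.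

Lemma mul2_linearr (f : M -> M) (b : T) :
  linear f -> linear (fun a => b * tin (f a)).
Proof. by move=> fL c x y; rewrite fL linearP mulrDr scalerAr. Qed.

Lemma tcup21_multilinear c :
  multilinear (fun w => if w is [:: a; b]
                        then tin (mu a c) * tin b + tin a * tin (mu b c) else 0).
Proof.
apply: (@multilinear2 _ (fun a b => tin (mu a c) * tin b + tin a * tin (mu b c))).
  move=> b k x y; rewrite [tin (mu _ c) * _](mul2_linearl _ (mu_l c)).
  by rewrite [tin _ * tin (mu b c)](@mul2_linearl id) // scalerDr addrACA.
move=> a k x y; rewrite [_ * tin (mu _ c)](mul2_linearr _ (mu_l c)).
by rewrite [_ * tin (k *: x + y)](@mul2_linearr id) // scalerDr addrACA.
Qed.

Lemma tcirc_multilinear_r a1 a2 :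
  multilinear (fun w => if w is [:: b1; b2]
                        then tin (mu a1 b1) * tin (mu a2 b2) else 0).
Proof.
apply: (@multilinear2 _ (fun b1 b2 => tin (mu a1 b1) * tin (mu a2 b2))) => b.
  exact/mul2_linearl/mu_r.
exact/mul2_linearr/mu_r.
Qed.

Lemma tlift_linear_fun (f g h : seq M -> T) (k : R) t :
  multilinear f -> multilinear g -> multilinear h ->
  (forall w, f w = k *: g w + h w) ->
  tlift f t = k *: tlift g t + tlift h t.
Proof.
move=> fM gM hM E; rewrite /tlift /flift scaler_sumr -big_split.
by apply: eq_bigr => i _ /=; rewrite E scalerDr !scalerA mulrC.
Qed.

Lemma tcirc_multilinear_l t :
  multilinear (fun w => if w is [:: a1; a2] then
    tlift (fun w' => if w' is [:: b1; b2]
                     then tin (mu a1 b1) * tin (mu a2 b2) else 0) t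
    else 0).
Proof.
apply: (@multilinear2 _ (fun a1 a2 => tlift _ t)) => b k x y /=;
  apply: tlift_linear_fun; try exact: tcirc_multilinear_r;
  move=> [|b1 [|b2 [|b3 w]]]; rewrite ?scaler0 ?addr0 //.
  exact: (mul2_linearl _ (mu_l b1)).
exact: (mul2_linearr _ (mu_l b2)).
Qed.

Lemma tcup11E a b : tcup11 (tin a) (tin b) = tin (mu a b).
Proof. by rewrite /tcup11 !tproj1E. Qed.

Lemma tcup21E a b c : tcup21 (tin a * tin b) (tin c) =
  tin (mu a c) * tin b + tin a * tin (mu b c).
Proof. by rewrite /tcup21 tproj1E tword2 tliftE //; apply: tcup21_multilinear. Qed.

Lemma tcircE a1 a2 b1 b2 : tcirc (tin a1 * tin a2) (tin b1 * tin b2) =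
  tin (mu a1 b1) * tin (mu a2 b2).
Proof.
rewrite /tcirc !tword2 tliftE; last exact: tcirc_multilinear_l.
by rewrite tliftE ?tword2 //; apply: tcirc_multilinear_r.
Qed.

Lemma tcup11_linearl t : linear (tcup11^~ t).
Proof. by move=> k x y; rewrite /tcup11 tproj1_linear mu_l linearP. Qed.

Lemma tcup11_linearr s : linear (tcup11 s).
Proof. by move=> k x y; rewrite /tcup11 tproj1_linear mu_r linearP. Qed.

Lemma tcup21_linearl t : linear (tcup21^~ t).
Proof. exact/tlift_linear/tcup21_multilinear. Qed.

Lemma tcup21_linearr s : linear (tcup21 s).
Proof.
move=> k x y; apply: tlift_linear_fun; try exact: tcup21_multilinear.
move=> [|a [|b [|? ?]]]; rewrite ?scaler0 ?addr0 // tproj1_linear !mu_r.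
by rewrite !linearP mulrDl mulrDr -scalerAl -scalerAr scalerDr addrACA.
Qed.

Lemma tcirc_linearl t : linear (tcirc^~ t).
Proof. exact/tlift_linear/tcirc_multilinear_l. Qed.

Lemma tcirc_linearr s : linear (tcirc s).
Proof.
move=> k x y; apply: tlift_linear_fun; try exact: tcirc_multilinear_l.
move=> [|a [|b [|? ?]]]; rewrite ?scaler0 ?addr0 //.
exact/tlift_linear/tcirc_multilinear_r.
Qed.

End TensorCup.

Section CupOneDga.
Variables (R : comNzRingType) (A : algType R).

(* Partial operations A^1 x A^1 -> A^1, D^2(A) x A^1 -> A^2 and               *)
(* D^2(A) x D^2(A) -> D^2(A), given as total functions of which only the      *)
(* values on these domains are ever constrained.                              *)
Record cup_one_ops := CupOneOps {
  cup11 : A -> A -> A;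
  cup21 : A -> A -> A;
  circ : A -> A -> A }.

Variables (gr : nat -> A -> Prop) (d : A -> A) (ops : cup_one_ops).

Definition submodule (V : lmodType R) (P : V -> Prop) : Prop :=
  P 0 /\ forall (c : R) u v, P u -> P v -> P (c *: u + v).

Definition bilinear_on (U V W : lmodType R)
    (P : U -> Prop) (Q : V -> Prop) (S : W -> Prop) (f : U -> V -> W) : Prop :=
  [/\ forall a b, P a -> Q b -> S (f a b),
      forall (c : R) a a' b, P a -> P a' -> Q b ->
        f (c *: a + a') b = c *: f a b + f a' b &
      forall (c : R) a b b', P a -> Q b -> Q b' ->
        f a (c *: b + b') = c *: f a b + f a b'].

Record graded_algebra : Prop := GradedAlgebra {
  gr_submodule : forall i, submodule (gr i);
  gr_one : gr 0%N 1;
  gr_mul : forall i j a b, gr i a -> gr j b -> gr (i + j)%N (a * b);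
  gr_span : forall a, exists (n : nat) (a_ : nat -> A),
    (forall i, gr i (a_ i)) /\ a = \sum_(i < n) a_ i;
  gr_direct : forall (n : nat) (a_ : nat -> A), (forall i, gr i (a_ i)) ->
    \sum_(i < n) a_ i = 0 -> forall i, (i < n)%N -> a_ i = 0 }.

Definition degree_one : Prop := forall i a, gr i a -> gr i.+1 (d a).

Definition graded_leibniz : Prop := forall i u v, gr i u ->
  d (u * v) = d u * v + (-1) ^+ i * u * d v.

Record dga : Prop := Dga {
  dga_graded : graded_algebra;
  dga_linear : linear d;
  dga_degree : degree_one;
  dga_square : forall a, d (d a) = 0;
  dga_leibniz : graded_leibniz }.

Definition D2 : A -> Prop :=
  lspan (fun t => exists a b, [/\ gr 1%N a, gr 1%N b & t = a * b]).

Definition cup1_d_formula (a b : A) : Prop :=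
  d (cup11 ops a b) =
    - (a * b) - b * a + cup21 ops (d a) b + cup21 ops (d b) a
    - circ ops (d a) (d b).

Record com_algebra_on (V : lmodType R) (S : V -> Prop)
    (mul : V -> V -> V) (one : V) : Prop := ComAlgebraOn {
  coa_submodule : submodule S;
  coa_bilinear : bilinear_on S S S mul;
  coa_one : S one;
  coa_mul1 : forall a, S a -> mul one a = a;
  coa_mulC : forall a b, S a -> S b -> mul a b = mul b a;
  coa_mulA : forall a b c, S a -> S b -> S c ->
    mul a (mul b c) = mul (mul a b) c }.

(* The algebra R (+) A^1, as a subset of R x A. *)
Definition unitized : (R^o * A)%type -> Prop := fun x => gr 1%N x.2.
Definition unitized_mul (x y : R^o * A) : R^o * A :=
  (x.1 * y.1, x.1 *: y.2 + y.1 *: x.2 + cup11 ops x.2 y.2).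
Definition unitized_one : (R^o * A)%type := (1, 0).

Record cup_one_dga : Prop := CupOneDga {
  cod_dga : dga;
  cod_cup11 : bilinear_on (gr 1%N) (gr 1%N) (gr 1%N) (cup11 ops);
  cod_cup21 : bilinear_on D2 (gr 1%N) (gr 2%N) (cup21 ops);
  cod_circ : bilinear_on D2 D2 D2 (circ ops);
  cod_unitized : com_algebra_on unitized unitized_mul unitized_one;
  cod_hirsch : forall a b c, gr 1%N a -> gr 1%N b -> gr 1%N c ->
    cup21 ops (a * b) c = a * cup11 ops b c + cup11 ops a c * b;
  cod_circE : forall u v w z, gr 1%N u -> gr 1%N v -> gr 1%N w -> gr 1%N z ->
    circ ops (u * v) (w * z) = cup11 ops u w * cup11 ops v z;
  cod_cup11_d : forall a c, gr 1%N a -> gr 0%N c ->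
    cup11 ops a (d c) = a * c - c * a;
  cod_cup1_d : forall a b, gr 1%N a -> gr 1%N b -> D2 (d a) -> D2 (d b) ->
    cup1_d_formula a b }.

End CupOneDga.

Inductive coef : Type := CoefZ | CoefFp (p : nat) of prime p.

Definition coef_ring (k : coef) : comNzRingType :=
  match k with CoefZ => int | CoefFp p _ => 'F_p end.

Definition falling (V : zmodType) (mul : V -> V -> V) (one a : V) (n : nat) : V :=
  \big[mul/one]_(i < n) (a - one *+ i).

Definition binomial_algebra_on (k : coef) (V : lmodType (coef_ring k))
    (S : V -> Prop) (mul : V -> V -> V) (one : V) : Prop :=
  com_algebra_on S mul one /\
  match k with
  | CoefZ =>
      (forall a n, S a -> (0 < n)%N -> a *+ n = 0 -> a = 0) /\
      (forall a n, S a -> (0 < n)%N ->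
        exists b, S b /\ b *+ n`! = falling mul one a n)
  | CoefFp p _ => forall a, S a -> falling mul one a p = 0
  end.

Record binomial_cup_one_dga (k : coef) (A : algType (coef_ring k))
    (gr : nat -> A -> Prop) (d : A -> A) (ops : cup_one_ops A) : Prop :=
  BinomialCupOneDga {
    bcd_cup_one : cup_one_dga gr d ops;
    bcd_deg0 : binomial_algebra_on (gr 0%N) *%R 1;
    bcd_unitized :
      binomial_algebra_on (unitized gr) (unitized_mul ops) (unitized_one A) }.

Definition IntR (k : coef) (X : choiceType) : comAlgType (coef_ring k) :=
  match k return comAlgType (coef_ring k) with
  | CoefZ => IntZ X
  | CoefFp p p_pr => IntFp p_pr X
  end.

Definition varR (k : coef) (X : choiceType) (x : X) : IntR k X :=
  match k return IntR k X with
  | CoefZ => varZ x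
  | CoefFp p p_pr => projFp p_pr (varZ x)
  end.

(* Over F_p: some integer-valued representative has zero constant term. *)
Definition zero_const (k : coef) (X : choiceType) : IntR k X -> Prop :=
  match k return IntR k X -> Prop with
  | CoefZ => fun q : IntZ X => (intz_val q)@_1%M = 0
  | CoefFp p p_pr => fun a : IntFp p_pr X =>
      exists2 q : IntZ X, (intz_val q)@_1%M = 0 & a = projFp p_pr q
  end.

Section AugmentationIdeal.
Variables (k : coef) (X : choiceType).

Definition zero_constb : IntR k X -> bool := fun a => `[< zero_const a >].

Lemma intz_const_scale (n : int) (q : IntZ X) :
  (intz_val q)@_1%M = 0 -> (intz_val (n *: q))@_1%M = 0.
Proof.
move=> hq; have -> : n *: q = n%:~R * q by rewrite -[LHS]/(q *~ n) mulrzl.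
by rewrite /= rmorphM /= hq mulr0.
Qed.

Lemma zero_const_submod : submod_closed zero_constb.
Proof.
rewrite /zero_constb; case: k => [|p p_pr] /=.
  split=> [|n q r /asboolP hq /asboolP hr]; apply/asboolP.
    by rewrite /= mcoeff0.
  by rewrite /= mcoeffD [X in X + _]intz_const_scale // hr addr0.
split=> [|n a b /asboolP[q hq ->] /asboolP[r hr ->]]; apply/asboolP.
  by exists 0; [rewrite /= mcoeff0 | rewrite /projFp rmorph0].
exists (n%:R * q + r).
  by rewrite /= mcoeffD rmorphM /= hq hr mulr0 addr0.
by rewrite /projFp rmorphD rmorphM rmorph_nat.
Qed.

HB.instance Definition _ :=
  GRing.isSubmodClosed.Build (coef_ring k) (IntR k X) zero_constb zero_const_submod.

Lemma zero_const_var x : varR k x \in zero_constb.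
Proof.
apply/asboolP; have hx : (pvar x)@_1%M = 0 by rewrite mcoeffU1 cm1_eq1.
by case: k => [|p p_pr] //=; exists (varZ x).
Qed.

Lemma zero_constM a b :
  a \in zero_constb -> b \in zero_constb -> a * b \in zero_constb.
Proof.
move=> /asboolP ha /asboolP hb; apply/asboolP; move: a b ha hb.
case: k => [|p p_pr] /=.
  by move=> q r hq hr; rewrite /= rmorphM /= hq mul0r.
move=> _ _ [q hq ->] [r hr ->]; exists (q * r); last by rewrite /projFp rmorphM.
by rewrite /= rmorphM /= hq mul0r.
Qed.

Record mIntR := MkMIntR { m_val :> IntR k X; _ : m_val \in zero_constb }.

HB.instance Definition _ := [isSub for m_val].
HB.instance Definition _ := [Choice of mIntR by <:].
HB.instance Definition _ := [SubChoice_isSubLmodule of mIntR by <:].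

Definition m_var (x : X) : mIntR := MkMIntR (zero_const_var x).

Definition m_mul (a b : mIntR) : mIntR :=
  MkMIntR (zero_constM (valP a) (valP b)).

Lemma m_mul_linearl b : linear (m_mul^~ b).
Proof.
by move=> c x y; apply: val_inj; rewrite /= mulrDl scalerAl.
Qed.

Lemma m_mul_linearr a : linear (m_mul a).
Proof.
by move=> c x y; apply: val_inj; rewrite /= mulrDr scalerAr.
Qed.

Definition freeT : algType (coef_ring k) := tensor_alg mIntR.

Definition freeT_grade : nat -> freeT -> Prop := @tgrade _ mIntR.

Definition freeT_var (x : X) : freeT := tin (m_var x).

Definition freeT_ops : cup_one_ops freeT :=
  CupOneOps (tcup11 m_mul) (tcup21 m_mul) (tcirc m_mul).

End AugmentationIdeal.

(* Main.v *)
Require Import Defs.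
From HB Require Import structures.
From mathcomp Require Import all_boot all_order all_algebra.
From mathcomp Require Import finfield finmap boolp monalg.

Set Implicit Arguments.
Unset Strict Implicit.
Unset Printing Implicit Defensive.

Import GRing.Theory Num.Theory.
Local Open Scope ring_scope.

Local Notation bilinear := (bilinear_for *:%R *:%R).

Local Notation "1" := (@mone _) : monom_scope.
Local Notation "x * y" := (mmul x y) : monom_scope.

(** Put [Delta x = x (x) 1 + 1 (x) x - d x] on the augmentation ideal [M = T^1] of
    the commutative algebra [A = Int(R^X)], and [Delta 1 = 1 (x) 1].  The cup-one/d
    formula says exactly that [Delta] is multiplicative for the componentwise
    product of tensors, and [d (d x)] is the difference of the two iterated
    coproducts [(Delta (x) 1) Delta] and [(1 (x) Delta) Delta] at [x].  Both of these
    are multiplicative, so the [x] at which they agree form a subring of [A].  This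
    subring contains the variables and is closed under division by the integers
    that are nonzero in [R], because the tensor algebra of [M] has no such torsion:
    over [Z] the Newton basis makes [M] a retract of a free module, whose tensor
    algebra is a free algebra.  Now [n! zeta_n(x) = x (x - 1) ... (x - n + 1)], where
    over [F_p] either [n!] is invertible or [zeta_n(x)] vanishes, so the subring is
    all of [A].  The Leibniz rule extends [d^2 = 0] from [M] to all tensors, and the
    algebras [T^0] and [R (+) T^1] are copies of the binomial rings [R] and [A]. *)

(** * Subrings, submodules and free modules *)

Definition is_subring (A : nzRingType) (P : A -> Prop) : Prop :=
  [/\ P 1, forall a b, P a -> P b -> P (a - b) & forall a b, P a -> P b -> P (a * b)].

Section Subring.
Variables (A : nzRingType) (P : A -> Prop).
Hypothesis subP : is_subring P.

Lemma is_subring1 : P 1. Proof. by case: subP. Qed.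

Lemma is_subringB a b : P a -> P b -> P (a - b).
Proof. by case: subP => _ PB _; apply: PB. Qed.

Lemma is_subringM a b : P a -> P b -> P (a * b).
Proof. by case: subP => _ _; apply. Qed.

Lemma is_subring0 : P 0.
Proof. by rewrite -(subrr 1); apply: is_subringB is_subring1 is_subring1. Qed.

Lemma is_subringN a : P a -> P (- a).
Proof. by rewrite -sub0r; apply: is_subringB is_subring0. Qed.

Lemma is_subringD a b : P a -> P b -> P (a + b).
Proof. by move=> Pa Pb; rewrite -[b]opprK; apply/is_subringB/is_subringN. Qed.

Lemma is_subringMn a n : P a -> P (a *+ n).
Proof.
move=> Pa; elim: n => [|n IH]; first exact: is_subring0.
by rewrite mulrS; apply: is_subringD.
Qed.

Lemma is_subringMz a z : P a -> P (a *~ z).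
Proof.
by case: z => n Pa; [apply: is_subringMn|apply/is_subringN/is_subringMn].
Qed.

Lemma is_subring_prod I (r : seq I) (F : I -> A) :
  (forall i, P (F i)) -> P (\prod_(i <- r) F i).
Proof. by move=> PF; apply: big_ind; [apply: is_subring1|apply: is_subringM|]. Qed.

End Subring.

Lemma linear_map0 (R : pzRingType) (U V : lmodType R) (f : U -> V) :
  linear f -> f 0 = 0.
Proof. by move=> fL; rewrite -(subrr 0) (zmod_morphism_linear fL) subrr. Qed.

Section Submodule.
Variables (R : comNzRingType) (V : lmodType R) (P : V -> Prop).
Hypothesis submodP : submodule P.

Lemma submodule0 : P 0. Proof. by case: submodP. Qed.

Lemma submoduleP c u v : P u -> P v -> P (c *: u + v).
Proof. by case: submodP => _; apply. Qed.

Lemma submoduleD u v : P u -> P v -> P (u + v).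
Proof. by rewrite -[u in u + v]scale1r; apply: submoduleP. Qed.

Lemma submoduleZ c u : P u -> P (c *: u).
Proof. by move=> Pu; rewrite -[_ *: u]addr0; apply: submoduleP submodule0. Qed.

Lemma submoduleB u v : P u -> P v -> P (u - v).
Proof. by move=> Pu Pv; rewrite addrC -scaleN1r; apply: submoduleP. Qed.

Lemma submodule_sum I (r : seq I) (F : I -> V) :
  (forall i, P (F i)) -> P (\sum_(i <- r) F i).
Proof. by move=> PF; apply: big_ind => //; [apply: submodule0|apply: submoduleD]. Qed.

Lemma submodule_preim (U : lmodType R) (f : U -> V) : linear f ->
  submodule (fun u => P (f u)).
Proof.
move=> fL; split=> [|c u v Pu Pv]; first by rewrite linear_map0 //; apply: submodule0.
by rewrite fL; apply: submoduleP.
Qed.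

End Submodule.

Section LinearSpan.
Variables (R : comNzRingType) (V : lmodType R) (P : V -> Prop).

Lemma lspan_gen v : P v -> lspan P v.
Proof.
move=> Pv; exists [:: (1, v)]; split; last by rewrite big_seq1 scale1r.
by move=> cw; rewrite inE => /eqP ->.
Qed.

Lemma lspan_submodule : submodule (lspan P).
Proof.
split=> [|c _ _ [s [sP ->]] [s' [sP' ->]]]; first by exists [::]; rewrite big_nil.
exists ([seq (c * cw.1, cw.2) | cw <- s] ++ s'); split=> [cw|].
  by rewrite mem_cat => /orP[/mapP[cw' /sP h ->]|/sP'].
rewrite big_cat big_map scaler_sumr; congr (_ + _).
by apply: eq_bigr => i _; rewrite scalerA.
Qed.

Lemma lspan_sub (Q : V -> Prop) : submodule Q -> (forall u, P u -> Q u) ->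
  forall v, lspan P v -> Q v.
Proof.
move=> subQ PQ _ [s [sP ->]]; rewrite big_seq; apply: big_ind => [|u v|cw /sP/PQ].
- exact: submodule0.
- exact: submoduleD.
- exact: submoduleZ.
Qed.

Lemma lspan_eq (W : lmodType R) (f g : V -> W) : linear f -> linear g ->
  (forall u, P u -> f u = g u) -> forall v, lspan P v -> f v = g v.
Proof.
move=> fL gL; apply: lspan_sub; split=> [|c u v fu fv].
  by rewrite !linear_map0.
by rewrite fL gL fu fv.
Qed.

End LinearSpan.

Section FreeModule.
Variables (R : nzRingType) (K : choiceType) (V : lmodType R) (b : K -> V).

Definition malg_lift (g : {malg R[K]}) : V := \sum_(k <- msupp g) g@_k *: b k.

Lemma malg_liftEw (E : {fset K}) g : (msupp g `<=` E)%fset ->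
  malg_lift g = \sum_(k <- E) g@_k *: b k.
Proof.
move=> le_gE; rewrite [LHS](big_fset_incl _ le_gE) => //= k _ /mcoeff_outdom ->.
by rewrite scale0r.
Qed.

Lemma malg_lift_linear : linear malg_lift.
Proof.
move=> c g h; pose E := (msupp g `|` msupp h `|` msupp (c *: g + h))%fset.
have [gE hE] : (msupp g `<=` E)%fset /\ (msupp h `<=` E)%fset.
  by rewrite /E -!fsetUA fsubsetUl fsetUCA fsubsetUl.
rewrite !(@malg_liftEw E) ?fsubsetUr // scaler_sumr -big_split.
by apply: eq_bigr => k _; rewrite /= mcoeffD mcoeffZ scalerDl scalerA.
Qed.

HB.instance Definition _ :=
  GRing.isLinear.Build R {malg R[K]} V _ malg_lift malg_lift_linear.

Lemma malg_liftU k : malg_lift << k >> = b k.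
Proof. by rewrite (malg_liftEw msuppU_le) big_seq_fset1 mcoeffUU scale1r. Qed.

End FreeModule.

Section FreeModuleTheory.
Variables (R : comNzRingType) (K : choiceType) (V : lmodType R).

Lemma malg_liftE (f : {linear {malg R[K]} -> V}) :
  f =1 malg_lift (fun k => f << k >>).
Proof.
move=> g; rewrite {1}[g]monalgE raddf_sum; apply: eq_bigr => k _ /=.
rewrite -linearZ_LR; congr (f _); apply/malgP => l.
by rewrite mcoeffZ !mcoeffU mulrnAr mulr1.
Qed.

Lemma lspan_malg_lift (b : K -> V) v :
  lspan (fun u => exists k, u = b k) v -> exists g, malg_lift b g = v.
Proof.
move: v; apply: lspan_sub => [|_ [k ->]]; last by exists << k >>; apply: malg_liftU.
split=> [|c _ _ [g <-] [h <-]]; first by exists 0; rewrite linear0.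
by exists (c *: g + h); rewrite linearP.
Qed.

End FreeModuleTheory.

Lemma malg_span (R : comNzRingType) (K : choiceType) (g : {malg R[K]}) :
  lspan (fun u => exists k, u = << k >>) g.
Proof.
rewrite -[g]/(idfun g) (malg_liftE idfun); apply: submodule_sum => [|k].
  exact: lspan_submodule.
by apply: (submoduleZ (lspan_submodule _)); apply: lspan_gen; exists k.
Qed.

Lemma malg_eq (R : comNzRingType) (K : choiceType) (V : lmodType R)
    (f g : {malg R[K]} -> V) : linear f -> linear g ->
  (forall k, f << k >> = g << k >>) -> f =1 g.
Proof.
move=> fL gL fg x; apply: (lspan_eq fL gL _ (malg_span x)) => _ [k ->].
exact: fg.
Qed.

(** * Tensor algebras *)

(* An abstract carrier: unification in [tensor_alg M] unfolds the operations of *)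
(* the quotient ring and does not terminate in practice.                        *)
Record tensor_model (R : comNzRingType) (M : lmodType R) := TensorModel {
  tensor_carrier :> algType R;
  tensor_in : {linear M -> tensor_carrier};
  tensor_lift : forall (V : lmodType R) (g : seq M -> V),
    multilinear g -> {linear tensor_carrier -> V};
  tensor_lift_prod : forall (V : lmodType R) (g : seq M -> V) (gM : multilinear g) w,
    tensor_lift gM (\prod_(a <- w) tensor_in a) = g w;
  tensor_span_prod : forall t,
    lspan (fun u => exists w, u = \prod_(a <- w) tensor_in a) t }.

Section TensorAlgModel.
Variables (R : comNzRingType) (M : lmodType R).

Lemma tpi_word (k : {fmonom M}) : tpi << k >> = tword (fmonom_val k).
Proof.
have -> : k = FMonom (fmonom_val k) by rewrite fmK.
rewrite /= /tword; elim: (fmonom_val k) => [|a w IH].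
  by rewrite big_nil -fmoneE -(rmorph1 (@tpi R M)).
rewrite big_cons -{}IH tinE /letter -rmorphM; congr tpi.
rewrite malgM_def fgmulUU mulr1; congr (<< _ >>).
by apply/eqP; rewrite fmP fmM fmU.
Qed.

Lemma tword_span (t : tensor_alg M) : lspan (fun u => exists w, u = tword w) t.
Proof.
elim/rq_ind: t => x; rewrite -[rproj _ x]/(tpi x) (malg_liftE (@tpi R M)).
apply: submodule_sum => [|k]; first exact: lspan_submodule.
apply: (submoduleZ (lspan_submodule _)).
by apply: lspan_gen; exists (fmonom_val k); apply: tpi_word.
Qed.

Definition tlift_linear_map (V : lmodType R) (g : seq M -> V) (gM : multilinear g) :
    {linear tensor_alg M -> V} :=
  HB.pack (tlift g) (GRing.isLinear.Build R _ V _ (tlift g) (tlift_linear gM)).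

Definition tensor_alg_model : tensor_model M :=
  @TensorModel R M (tensor_alg M) (@tin R M) tlift_linear_map (@tliftE R M) tword_span.

End TensorAlgModel.

Section TensorWords.
Variables (R : comNzRingType) (M : lmodType R) (T : tensor_model M).
Local Notation tin := (tensor_in T).

Definition word (w : seq M) : T := \prod_(a <- w) tin a.

Definition grade (n : nat) : T -> Prop :=
  lspan (fun t => exists w : n.-tuple M, t = word w).

Lemma word_nil : word [::] = 1. Proof. by rewrite /word big_nil. Qed.

Lemma word_cons a w : word (a :: w) = tin a * word w.
Proof. by rewrite /word big_cons. Qed.

Lemma word1 a : word [:: a] = tin a. Proof. by rewrite /word big_seq1. Qed.

Lemma word2 a b : word [:: a; b] = tin a * tin b.
Proof. by rewrite word_cons word1. Qed.

Lemma word_cat w w' : word (w ++ w') = word w * word w'.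
Proof. by rewrite /word big_cat. Qed.

Lemma word_multilinear : multilinear word.
Proof.
move=> w w' c a b; rewrite !word_cat !word_cons linearP.
by rewrite mulrDl mulrDr -scalerAl -scalerAr.
Qed.

Lemma tensor_lift_word (V : lmodType R) (g : seq M -> V) (gM : multilinear g) w :
  tensor_lift T gM (word w) = g w.
Proof. exact: tensor_lift_prod. Qed.

Lemma tensor_ind (Q : T -> Prop) : submodule Q -> (forall w, Q (word w)) ->
  forall t, Q t.
Proof.
move=> QS Qw t; apply: (lspan_sub QS _ (tensor_span_prod t)) => _ [w ->].
exact: Qw.
Qed.

Lemma tensor_eq (V : lmodType R) (f g : T -> V) : linear f -> linear g ->
  (forall w, f (word w) = g (word w)) -> f =1 g.
Proof.
move=> fL gL fg t; apply: (lspan_eq fL gL _ (tensor_span_prod t)) => _ [w ->].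
exact: fg.
Qed.

Lemma grade_ind n (Q : T -> Prop) : submodule Q ->
  (forall w, size w = n -> Q (word w)) -> forall t, grade n t -> Q t.
Proof.
by move=> QS Qw; apply: lspan_sub => // _ [w ->]; apply: Qw; rewrite size_tuple.
Qed.

Lemma grade_eq n (V : lmodType R) (f g : T -> V) : linear f -> linear g ->
  (forall w, size w = n -> f (word w) = g (word w)) ->
  forall t, grade n t -> f t = g t.
Proof.
by move=> fL gL fg; apply: lspan_eq => // _ [w ->]; rewrite fg ?size_tuple.
Qed.

Lemma grade_submodule n : submodule (grade n). Proof. exact: lspan_submodule. Qed.

Lemma grade_word w : grade (size w) (word w).
Proof. by apply: lspan_gen; exists (in_tuple w). Qed.

Lemma grade_one : grade 0 1. Proof. by rewrite -word_nil; apply: (grade_word [::]). Qed.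

Lemma grade_tin a : grade 1 (tin a).
Proof. by rewrite -word1; apply: (grade_word [:: a]). Qed.

Lemma gradeM i j s t : grade i s -> grade j t -> grade (i + j) (s * t).
Proof.
move=> hs ht; move: s hs; apply: grade_ind => [|w <-].
  by apply: (submodule_preim (grade_submodule _)) => c x y; rewrite mulrDl scalerAl.
move: t ht; apply: grade_ind => [|w' <-].
  by apply: (submodule_preim (grade_submodule _)) => c x y; rewrite mulrDr scalerAr.
by rewrite -word_cat -size_cat; apply: grade_word.
Qed.

Lemma grade_tin2 a b : grade 2 (tin a * tin b).
Proof. by rewrite -word2; apply: (grade_word [:: a; b]). Qed.

Lemma grade0P t : grade 0 t -> exists c : R, t = c%:A.
Proof.
move: t; apply: grade_ind => [|[] // _]; last by exists 1; rewrite scale1r word_nil.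
split=> [|c _ _ [a ->] [b ->]]; first by exists 0; rewrite scale0r.
by exists (c * a + b); rewrite scalerDl scalerA.
Qed.

Lemma grade1P t : grade 1 t -> exists a, t = tin a.
Proof.
move: t; apply: grade_ind => [|[|a []] // _]; last by exists a; rewrite word1.
split=> [|c _ _ [a ->] [b ->]]; first by exists 0; rewrite raddf0.
by exists (c *: a + b); rewrite linearP.
Qed.

Lemma D2E : D2 grade = grade 2.
Proof.
apply/funext => t; apply/propext; split; move: t; apply: lspan_sub.
- exact: grade_submodule.
- by move=> _ [a [b [ha hb ->]]]; apply: (gradeM ha hb).
- exact: lspan_submodule.
move=> _ [[[|a [|b []]] // sw] ->]; apply: lspan_gen; exists (tin a), (tin b).
by split; [apply: grade_tin|apply: grade_tin|rewrite word2].
Qed.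

Lemma bilinear_grade_eq m n (V : lmodType R) (f g : T -> T -> V) :
    bilinear f -> bilinear g ->
    (forall w w', size w = m -> size w' = n ->
       f (word w) (word w') = g (word w) (word w')) ->
  forall s t, grade m s -> grade n t -> f s t = g s t.
Proof.
move=> fB gB fg s t hs ht; move: s hs.
apply: grade_eq (fB.1 t) (gB.1 t) _ => w sw; move: t ht.
by apply: grade_eq (fB.2 _) (gB.2 _) _ => w' sw'; apply: fg.
Qed.

Lemma bilinear_on_grade m n l (f : T -> T -> T) : bilinear f ->
    (forall w w', size w = m -> size w' = n -> grade l (f (word w) (word w'))) ->
  bilinear_on (grade m) (grade n) (grade l) f.
Proof.
move=> fB fg.
split=> [s t hs ht|c s s' t _ _ _|c s t t' _ _ _]; [|exact: fB.1|exact: fB.2].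
move: s hs; apply: grade_ind => [|w sw].
  exact: (submodule_preim (grade_submodule l) (fB.1 _)).
move: t ht; apply: grade_ind => [|w' sw']; last exact: fg.
exact: (submodule_preim (grade_submodule l) (fB.2 _)).
Qed.

End TensorWords.

Section TensorGrading.
Variables (R : comNzRingType) (M : lmodType R) (T : tensor_model M).
Local Notation word := (word T).
Local Notation grade := (@grade R M T).

Lemma tensor_component_multilinear n :
  multilinear (fun w : seq M => if size w == n then word w else 0).
Proof.
move=> w w' c a b; rewrite !size_cat /=.
by case: ifP => _; [apply: word_multilinear|rewrite scaler0 addr0].
Qed.

Definition tensor_component n : {linear T -> T} :=
  tensor_lift T (tensor_component_multilinear n).

Lemma tensor_component_word n w :
  tensor_component n (word w) = if size w == n then word w else 0.
Proof. exact: tensor_lift_word. Qed.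

Lemma tensor_component_grade n m t :
  grade m t -> tensor_component n t = if m == n then t else 0.
Proof.
move: t; apply: (grade_eq (g := fun t => if m == n then t else 0)) => [||w <-].
- exact: linearP.
- by move=> c x y; case: ifP; rewrite ?scaler0 ?addr0.
- exact: tensor_component_word.
Qed.

Lemma grade_tensor_component n t : grade n (tensor_component n t).
Proof.
move: t; apply: tensor_ind => [|w].
  exact: (submodule_preim (grade_submodule T n) (linearP _)).
rewrite tensor_component_word; case: eqP => [<-|_]; first exact: grade_word.
exact: submodule0 (grade_submodule T n).
Qed.

Lemma sum_tensor_component t : exists n, forall m, (n <= m)%N ->
  t = \sum_(i < m) tensor_component i t.
Proof.
move: t; apply: tensor_ind => [|w].
  split=> [|c u v [n un] [m vm]].
    by exists 0%N => m _; rewrite big1 // => i _; rewrite linear0.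
  exists (maxn n m) => l; rewrite geq_max => /andP[/un {1}-> /vm {1}->].
  rewrite scaler_sumr -big_split; apply: eq_bigr => i _ /=.
  by rewrite linearP.
exists (size w).+1 => m wm; rewrite (bigD1 (Ordinal wm)) //=.
rewrite tensor_component_word eqxx big1 ?addr0 // => i wi.
by rewrite tensor_component_word eq_sym -val_eqE /= in wi *; rewrite (negPf wi).
Qed.

Lemma tensor_graded : graded_algebra grade.
Proof.
split=> [||||n a_ grade_a sum_a i lt_in].
- exact: grade_submodule.
- exact: grade_one.
- exact: gradeM.
- move=> t; have [n tE] := sum_tensor_component t.
  exists n, (tensor_component^~ t); split; last exact: tE.
  by move=> i; apply: grade_tensor_component.
have := congr1 (tensor_component i) sum_a.
rewrite linear0 linear_sum (bigD1 (Ordinal lt_in)) //=.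
rewrite (tensor_component_grade i (grade_a i)) eqxx big1 ?addr0 // => j.
by rewrite -val_eqE (tensor_component_grade i (grade_a j)) /= => /negPf ->.
Qed.

End TensorGrading.

Section TensorMorphism.
Variables (R : comNzRingType) (M : lmodType R) (T : tensor_model M).
Variables (B : algType R) (f : {linear M -> B}).

Lemma prod_multilinear : multilinear (fun w : seq M => \prod_(a <- w) f a).
Proof.
move=> w w' c a b; rewrite !big_cat !big_cons /= linearP.
by rewrite mulrDl mulrDr -scalerAl -scalerAr.
Qed.

Definition tensor_morph : T -> B := tensor_lift T prod_multilinear.

Lemma tensor_morph_word w : tensor_morph (word T w) = \prod_(a <- w) f a.
Proof. exact: tensor_lift_word. Qed.

HB.instance Definition _ :=
  GRing.Linear.copy tensor_morph (tensor_lift T prod_multilinear).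

Lemma tensor_morph_monoid : monoid_morphism tensor_morph.
Proof.
split=> [|s t]; first by rewrite -(word_nil T) tensor_morph_word big_nil.
move: s; apply: tensor_eq => [c x y|c x y|w].
- by rewrite mulrDl -scalerAl linearP.
- by rewrite linearP mulrDl -scalerAl.
move: t; apply: tensor_eq => [c x y|c x y|w'].
- by rewrite mulrDr -scalerAr linearP.
- by rewrite linearP mulrDr -scalerAr.
by rewrite -word_cat !tensor_morph_word big_cat.
Qed.

HB.instance Definition _ :=
  GRing.isMonoidMorphism.Build T B tensor_morph tensor_morph_monoid.

Lemma tensor_morph_in a : tensor_morph (tensor_in T a) = f a.
Proof. by rewrite -word1 tensor_morph_word big_seq1. Qed.

End TensorMorphism.

Lemma tensor_in_inj (R : comNzRingType) (M : lmodType R) (T : tensor_model M) :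
  injective (tensor_in T).
Proof.
have gM : multilinear (fun w : seq M => if w is [:: a] then a else 0).
  exact: (@multilinear1 R M M id).
by apply: (can_inj (g := tensor_lift T gM)) => a; rewrite -word1 tensor_lift_word.
Qed.

Section TensorMap.
Variables (R : comNzRingType) (M N : lmodType R).
Variables (T : tensor_model M) (U : tensor_model N).

Definition tensor_map (f : {linear M -> N}) : T -> U :=
  tensor_morph (tensor_in U \o f).

HB.instance Definition _ f := GRing.LRMorphism.on (tensor_map f).

Lemma tensor_map_in f a : tensor_map f (tensor_in T a) = tensor_in U (f a).
Proof. exact: tensor_morph_in. Qed.

Lemma tensor_map_word f w : tensor_map f (word T w) = word U (map f w).
Proof. by rewrite /tensor_map tensor_morph_word /word big_map. Qed.

Lemma grade_tensor_map f n t : grade n t -> grade n (tensor_map f t).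
Proof.
move: t; apply: grade_ind => [|w <-].
  exact: (submodule_preim (grade_submodule U n) (linearP _)).
by rewrite tensor_map_word -(size_map f); apply: grade_word.
Qed.

End TensorMap.

Lemma tensor_mapK (R : comNzRingType) (M N : lmodType R)
    (T : tensor_model M) (U : tensor_model N)
    (f : {linear M -> N}) (g : {linear N -> M}) :
  cancel f g -> cancel (@tensor_map _ _ _ T U f) (@tensor_map _ _ _ U T g).
Proof.
move=> fK; apply: tensor_eq => [c x y|//|w]; first by rewrite !linearP.
by rewrite !tensor_map_word mapK.
Qed.

Arguments tensor_mapK {R M N} T U {f g}.

Section FreeAlgebra.
Variables (R : comNzRingType) (K : choiceType).

Definition free_algebra : Type := {malg R[{fmonom K}]}.
HB.instance Definition _ := GRing.Lalgebra.on free_algebra.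

Lemma malg_scaleAr (L : monomType) (c : R) (g h : {malg R[L]}) :
  c *: (g * h) = g * (c *: h).
Proof.
rewrite -(mul_malgC c (g * h)) -(mul_malgC c h) !mulrA.
suff -> : c%:MP * g = g * c%:MP by [].
rewrite {1 2}[g]monalgE mulr_sumr mulr_suml; apply: eq_bigr => k _.
by rewrite 2!malgM_def 2!fgmulUU mulrC mul1m mulm1.
Qed.

HB.instance Definition _ :=
  GRing.Lalgebra_isAlgebra.Build R free_algebra (@malg_scaleAr {fmonom K}).

Variable T : tensor_model {malg R[K]}.

Definition free_letter : {linear {malg R[K]} -> free_algebra} :=
  malg_lift (fun x => << fmu x >> : free_algebra).

Definition free_word (k : {fmonom K}) : T :=
  word T [seq << x >> | x <- fmonom_val k].

Lemma malg_lift_free_letter a (u : free_algebra) :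
  malg_lift free_word (free_letter a * u) = tensor_in T a * malg_lift free_word u.
Proof.
move: a; apply: malg_eq => [c x y|c x y|x].
- by rewrite linearP mulrDl -scalerAl linearP.
- by rewrite linearP mulrDl -scalerAl.
move: u; apply: malg_eq => [c u v|c u v|k].
- by rewrite mulrDr -scalerAr linearP.
- by rewrite linearP mulrDr -scalerAr.
have -> : free_letter << x >> * << k >> = << (fmu x * k)%M >> :> free_algebra.
  by rewrite [free_letter _]malg_liftU [LHS]malgM_def fgmulUU mulr1.
by rewrite !malg_liftU -word_cons /free_word fmM fmU.
Qed.

Lemma tensor_morph_free_letterK :
  cancel (tensor_morph free_letter : T -> free_algebra) (malg_lift free_word).
Proof.
apply: tensor_eq => [c x y|//|w]; first by rewrite !linearP.
rewrite tensor_morph_word; elim: w => [|a w IH].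
  by rewrite big_nil word_nil [LHS](malg_liftU _ 1%M) /free_word fm1 word_nil.
by rewrite big_cons malg_lift_free_letter IH word_cons.
Qed.

End FreeAlgebra.

Lemma retract_mulrn_eq0 (U V : zmodType) (f : {additive U -> V}) (g : V -> U) n :
  cancel f g -> (forall v : V, v *+ n = 0 -> v = 0) ->
  forall u : U, u *+ n = 0 -> u = 0.
Proof.
move=> fK V_reg u un; apply: (can_inj fK); rewrite raddf0; apply: V_reg.
by rewrite -raddfMn un raddf0.
Qed.

Lemma tensor_mulrn_eq0 (R : comNzRingType) (M : lmodType R) (T : tensor_model M)
    (K : choiceType) (f : M -> {malg R[K]}) (g : {malg R[K]} -> M) n :
  linear f -> linear g -> cancel f g -> (forall r : R, r *+ n = 0 -> r = 0) ->
  forall t : T, t *+ n = 0 -> t = 0.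
Proof.
move=> fL gL fK R_reg; pose U := tensor_alg_model {malg R[K]}.
pose F : {linear M -> _} := HB.pack f (GRing.isLinear.Build R M _ _ f fL).
pose G : {linear _ -> M} := HB.pack g (GRing.isLinear.Build R _ M _ g gL).
apply: (retract_mulrn_eq0 (tensor_mapK T U (fK : cancel F G))).
apply: (retract_mulrn_eq0 (@tensor_morph_free_letterK _ _ U)) => h hn.
by apply/malgP => k; rewrite mcoeff0; apply: R_reg; rewrite -mcoeffMn hn mcoeff0.
Qed.

Section TensorSquare.
Variables (R : comNzRingType) (M : lmodType R) (T : tensor_model M).
Variables (B : algType R) (f g : {linear M -> B}).

Lemma tensor2_multilinear :
  multilinear (fun w : seq M => if w is [:: a; b] then f a * g b else 0).
Proof.
apply: (multilinear2 (f := fun a b => f a * g b)) => [b|a] c x y.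
  by rewrite linearP mulrDl scalerAl.
by rewrite linearP mulrDr scalerAr.
Qed.

Definition tensor2_lift : {linear T -> B} := tensor_lift T tensor2_multilinear.

Lemma tensor2_liftE a b :
  tensor2_lift (tensor_in T a * tensor_in T b) = f a * g b.
Proof. by rewrite -word2 /tensor2_lift tensor_lift_word. Qed.

End TensorSquare.

Section Hadamard.
Variables (R : comNzRingType) (A : comAlgType R) (T : tensor_model A).
Local Notation tin := (tensor_in T).
Local Notation word := (word T).
Local Notation grade := (@grade R A T).

Fixpoint hadamard_word (w w' : seq A) : T :=
  match w, w' with
  | [::], [::] => 1
  | a :: u, b :: u' => tin (a * b) * hadamard_word u u'
  | _, _ => 0
  end.

Lemma hadamard_wordC w w' : hadamard_word w w' = hadamard_word w' w.
Proof. by elim: w w' => [|a w IH] [|b w'] //=; rewrite IH mulrC. Qed.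

Lemma hadamard_word_cat u u' w w' : size u = size u' ->
  hadamard_word (u ++ w) (u' ++ w') = hadamard_word u u' * hadamard_word w w'.
Proof.
elim: u u' => [|a u IH] [|b u'] //=; first by rewrite mul1r.
by case=> /IH ->; rewrite mulrA.
Qed.

Lemma hadamard_word_multilinear w : multilinear (hadamard_word w).
Proof.
elim: w => [|a w IH] [|z u] w' c x y /=; rewrite ?scaler0 ?addr0 //.
  by rewrite mulrDr -scalerAr linearP mulrDl scalerAl.
by rewrite IH mulrDr scalerAr.
Qed.

Lemma hadamard_multilinear t :
  multilinear (fun w => tensor_lift T (hadamard_word_multilinear w) t).
Proof.
move=> w w' c a b; move: t.
apply: (tensor_eq (linearP _) (linearP (c \*: _ \+ _))) => u /=.
rewrite !tensor_lift_word ![hadamard_word _ u]hadamard_wordC.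
exact: hadamard_word_multilinear.
Qed.

Definition hadamard (s t : T) : T := tensor_lift T (hadamard_multilinear t) s.

Lemma hadamardE w w' : hadamard (word w) (word w') = hadamard_word w w'.
Proof. by rewrite /hadamard !tensor_lift_word. Qed.

Lemma hadamard_bilinear : bilinear hadamard.
Proof.
split=> [t|s] c x y; first exact: linearP.
move: s; apply: (tensor_eq (linearP _) (linearP (c \*: _ \+ _))) => w /=.
by rewrite !tensor_lift_word linearP.
Qed.

HB.instance Definition _ :=
  bilinear_isBilinear.Build R T T T _ _ hadamard hadamard_bilinear.

Lemma hadamard_tin a b : hadamard (tin a) (tin b) = tin (a * b).
Proof. by rewrite -!word1 hadamardE /= mulr1 word1. Qed.

Lemma hadamard2 a b a' b' :
  hadamard (tin a * tin b) (tin a' * tin b') = tin (a * a') * tin (b * b').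
Proof. by rewrite -!word2 hadamardE /= mulr1 word2. Qed.

Lemma hadamardM m n s s' t t' : grade m s -> grade m s' -> grade n t -> grade n t' ->
  hadamard (s * t) (s' * t') = hadamard s s' * hadamard t t'.
Proof.
move=> hs hs' ht ht'; move: s s' hs hs'.
apply: (bilinear_grade_eq (f := fun s s' => hadamard (s * t) (s' * t'))
  (g := fun s s' => hadamard s s' * _)) => [||w w' <- sw'].
- by split=> z c x y; rewrite mulrDl -scalerAl; [exact: linearPl|exact: linearPr].
- split=> z c x y; [rewrite linearPl|rewrite linearPr]; by rewrite mulrDl -scalerAl.
move: t t' ht ht'.
apply: (bilinear_grade_eq (f := fun t t' => hadamard (_ * t) (_ * t'))
  (g := fun t t' => _ * hadamard t t')) => [||u u' _ _].
- by split=> z c x y; rewrite mulrDr -scalerAr; [exact: linearPl|exact: linearPr].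
- split=> z c x y; [rewrite linearPl|rewrite linearPr]; by rewrite mulrDr -scalerAr.
by rewrite -!word_cat !hadamardE hadamard_word_cat.
Qed.

Lemma hadamardC s t : hadamard s t = hadamard t s.
Proof.
move: s; apply: tensor_eq (hadamard_bilinear.1 t) (hadamard_bilinear.2 t) _ => w.
move: t; apply: tensor_eq (hadamard_bilinear.2 _) (hadamard_bilinear.1 _) _ => w'.
by rewrite !hadamardE hadamard_wordC.
Qed.

Lemma hadamard_one2 t : grade 2 t -> hadamard (tin 1 * tin 1) t = t.
Proof.
move: t; apply: (grade_eq (hadamard_bilinear.2 _) (g := id)) => // -[|a [|b []]] // _.
by rewrite word2 hadamard2 !mul1r.
Qed.

Lemma tensor2_lift_hadamard (f g : {linear A -> T}) m n :
    (forall x, grade m (f x)) -> (forall x, grade n (g x)) ->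
    (forall x y, f (x * y) = hadamard (f x) (f y)) ->
    (forall x y, g (x * y) = hadamard (g x) (g y)) ->
  forall s t, grade 2 s -> grade 2 t ->
    tensor2_lift T f g (hadamard s t) =
    hadamard (tensor2_lift T f g s) (tensor2_lift T f g t).
Proof.
move=> fG gG fM gM; set F := tensor2_lift T f g.
apply: (bilinear_grade_eq (f := fun s t => F (hadamard s t))
  (g := fun s t => hadamard (F s) (F t))) => [||[|a [|b []]] // [|a' [|b' []]] // _ _].
- by split=> z c x y; [rewrite linearPl|rewrite linearPr]; apply: linearP.
- by split=> z c x y; rewrite linearP; [exact: linearPl|exact: linearPr].
by rewrite !word2 hadamard2 !tensor2_liftE (hadamardM (m := m) (n := n)) ?fM ?gM.
Qed.

End Hadamard.

(** * Cup-one differentials on the augmentation ideal of a commutative algebra *)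

Record augmentation (R : comNzRingType) (A : comAlgType R) (M : lmodType R)
    (mu : M -> M -> M) := Augmentation {
  counit : {linear A -> R^o};
  aug_incl : {linear M -> A};
  aug_proj : {linear A -> M};
  counit1 : counit 1 = 1;
  counit_incl : forall a, counit (aug_incl a) = 0;
  aug_inclK : cancel aug_incl aug_proj;
  aug_split : forall x, x = (counit x)%:A + aug_incl (aug_proj x);
  aug_inclM : {morph aug_incl : a b / mu a b >-> a * b} }.

Section AugmentationTheory.
Variables (R : comNzRingType) (A : comAlgType R) (M : lmodType R) (mu : M -> M -> M).
Variable aug : augmentation A mu.
Local Notation eps := (counit aug).
Local Notation incl := (aug_incl aug).
Local Notation proj := (aug_proj aug).

Lemma aug_proj1 : proj 1 = 0.
Proof.
apply: (can_inj (aug_inclK aug)); apply: (addrI (eps 1)%:A).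
by rewrite -aug_split linear0 counit1 scale1r addr0.
Qed.

Lemma counit_split r a : eps (r%:A + incl a) = r.
Proof. by rewrite linearD linearZ_LR counit1 counit_incl addr0 [LHS]mulr1. Qed.

Lemma aug_proj_split r a : proj (r%:A + incl a) = a.
Proof. by rewrite linearD linearZ_LR aug_proj1 scaler0 add0r aug_inclK. Qed.

Lemma aug_mulE x y : x * y = (eps x * eps y)%:A +
  incl (eps x *: proj y + eps y *: proj x + mu (proj x) (proj y)).
Proof.
rewrite {1}[x](aug_split aug) {1}[y](aug_split aug) mulrDl !mulrDr.
rewrite !linearD !linearZ_LR /= aug_inclM mulr_algl scalerA mulr_algl mulr_algr.
by rewrite !addrA.
Qed.

Lemma counitM x y : eps (x * y) = eps x * eps y.
Proof. by rewrite aug_mulE counit_split. Qed.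

Lemma aug_projM x y :
  proj (x * y) = eps x *: proj y + eps y *: proj x + mu (proj x) (proj y).
Proof. by rewrite aug_mulE aug_proj_split. Qed.

End AugmentationTheory.

Record tensor_cup_one (R : comNzRingType) (M : lmodType R) (T : tensor_model M)
    (mu : M -> M -> M) (ops : cup_one_ops T) : Prop := TensorCupOne {
  cup11_in : forall a b,
    cup11 ops (tensor_in T a) (tensor_in T b) = tensor_in T (mu a b);
  cup21_in : forall a b c,
    cup21 ops (tensor_in T a * tensor_in T b) (tensor_in T c) =
    tensor_in T (mu a c) * tensor_in T b + tensor_in T a * tensor_in T (mu b c);
  circ_in : forall a b a' b',
    circ ops (tensor_in T a * tensor_in T b) (tensor_in T a' * tensor_in T b') =
    tensor_in T (mu a a') * tensor_in T (mu b b');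
  cup11_bilinear : bilinear (cup11 ops);
  cup21_bilinear : bilinear (cup21 ops);
  circ_bilinear : bilinear (circ ops) }.

Section Coproduct.
Variables (R : comNzRingType) (A : comAlgType R) (M : lmodType R) (mu : M -> M -> M).
Variable aug : augmentation A mu.
Variables (T : tensor_model M) (U : tensor_model A) (ops : cup_one_ops T).
Variable d : {linear T -> T}.
Local Notation incl := (aug_incl aug).
Local Notation proj := (aug_proj aug).
Local Notation J := (@tensor_map _ _ _ T U incl).
Local Notation e := (tensor_in U 1).

Definition primitive (x : A) : U := tensor_in U x * e + e * tensor_in U x.

Lemma primitive_linear : linear primitive.
Proof. exact: (linearP ((e \o* tensor_in U) \+ (e \*o tensor_in U))). Qed.

HB.instance Definition _ := GRing.isLinear.Build R A U _ primitive primitive_linear.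

Definition reduced_coprod (a : M) : U := primitive (incl a) - J (d (tensor_in T a)).

Lemma reduced_coprod_linear : linear reduced_coprod.
Proof. exact: (linearP ((primitive \o incl) \- (J \o d \o tensor_in T))). Qed.

HB.instance Definition _ :=
  GRing.isLinear.Build R M U _ reduced_coprod reduced_coprod_linear.

Definition coprod (x : A) : U := counit aug x *: (e * e) + reduced_coprod (proj x).

Lemma coprod_linear : linear coprod.
Proof.
move=> c x y; rewrite /coprod (linearP proj) reduced_coprod_linear.
by rewrite (linearP (counit aug)) scalerDl -scalerA [in RHS]scalerDr addrACA.
Qed.

HB.instance Definition _ := GRing.isLinear.Build R A U _ coprod coprod_linear.

Definition lcoprod : {linear U -> U} := tensor2_lift U coprod (tensor_in U).
Definition rcoprod : {linear U -> U} := tensor2_lift U (tensor_in U) coprod.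

Lemma coprod_one : coprod 1 = e * e.
Proof. by rewrite /coprod counit1 scale1r aug_proj1 linear0 addr0. Qed.

Lemma coprod_incl a : coprod (incl a) = reduced_coprod a.
Proof. by rewrite /coprod counit_incl scale0r add0r aug_inclK. Qed.

Lemma hadamard_primitive x y : hadamard (primitive x) (primitive y) =
  primitive (x * y) + tensor_in U x * tensor_in U y + tensor_in U y * tensor_in U x.
Proof.
rewrite /primitive linearDl !linearDr /= !hadamard2 !mul1r !mulr1.
by rewrite !addrA (ACl (1*4*2*3))%AC.
Qed.

Lemma grade_primitive x : grade 2 (primitive x).
Proof. by apply: (submoduleD (grade_submodule U 2)); apply: grade_tin2. Qed.

Section Multiplicativity.
Hypothesis opsP : tensor_cup_one mu ops.
Hypothesis d_degree : degree_one (@grade R M T) d.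
Hypothesis d_cup1 : forall a b, cup1_d_formula d ops (tensor_in T a) (tensor_in T b).

Lemma grade_d_in a : grade 2 (d (tensor_in T a)).
Proof. exact/d_degree/grade_tin. Qed.

Lemma grade_coprod x : grade 2 (coprod x).
Proof.
apply: (submoduleD (grade_submodule U 2)).
  by apply: (submoduleZ (grade_submodule U 2)); apply: grade_tin2.
apply: (submoduleB (grade_submodule U 2)); first exact: grade_primitive.
exact/grade_tensor_map/grade_d_in.
Qed.

Lemma hadamard_incl_primitive b t : grade 2 t ->
  hadamard (J t) (primitive (incl b)) = J (cup21 ops t (tensor_in T b)).
Proof.
move: t; apply: grade_eq => [c x y|c x y|[|x [|y []]] // _].
- by rewrite linearP linearPl.
- by rewrite (cup21_bilinear opsP).1 linearP.
rewrite word2 (cup21_in opsP) rmorphD !rmorphM /= !tensor_map_in !aug_inclM.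
by rewrite /primitive linearDr /= !hadamard2 !mulr1.
Qed.

Lemma hadamard_incl s t : grade 2 s -> grade 2 t ->
  hadamard (J s) (J t) = J (circ ops s t).
Proof.
move: s t; apply: bilinear_grade_eq => [||[|x [|y []]] // [|x' [|y' []]] // _ _].
- by split=> z c x y; rewrite linearP; [exact: linearPl|exact: linearPr].
- have [cl cr] := circ_bilinear opsP.
  by split=> z c x y; rewrite ?cl ?cr linearP.
by rewrite !word2 (circ_in opsP) !rmorphM /= !tensor_map_in !aug_inclM hadamard2.
Qed.

(* The cup-one/d formula says exactly that the coproduct is multiplicative. *)
Lemma reduced_coprodM a b :
  reduced_coprod (mu a b) = hadamard (reduced_coprod a) (reduced_coprod b).
Proof.
rewrite {1}/reduced_coprod -(cup11_in opsP) d_cup1 aug_inclM.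
rewrite [in RHS]/reduced_coprod linearBl !linearBr /=.
rewrite [hadamard (primitive _) (J _)]hadamardC hadamard_primitive.
rewrite !hadamard_incl_primitive ?hadamard_incl; try exact: grade_d_in.
rewrite rmorphB !rmorphD !rmorphN !rmorphM /= !tensor_map_in !opprD !opprK !addrA.
by rewrite [LHS](ACl (1*2*3*5*4*6))%AC.
Qed.

Lemma coprodM x y : coprod (x * y) = hadamard (coprod x) (coprod y).
Proof.
have hadamard_2one t : grade 2 t -> hadamard t (e * e) = t.
  by move=> ht; rewrite hadamardC hadamard_one2.
have grade_reduced a : grade 2 (reduced_coprod a).
  by rewrite -coprod_incl; apply: grade_coprod.
rewrite /coprod counitM aug_projM !linearD !linearZ_LR /= reduced_coprodM.
move: (reduced_coprod _) (reduced_coprod _) (grade_reduced (proj x))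
  (grade_reduced (proj y)) => a b ha hb.
have grade_e2 : grade 2 (e * e) by apply: grade_tin2.
rewrite linearDl !linearDr !linearZl_LR !linearZr_LR /= !hadamard_one2 //.
by rewrite hadamard_2one // scalerA !addrA.
Qed.

Lemma lcoprodM s t : grade 2 s -> grade 2 t ->
  lcoprod (hadamard s t) = hadamard (lcoprod s) (lcoprod t).
Proof.
apply: (tensor2_lift_hadamard (m := 2) (n := 1)) => *.
- exact: grade_coprod.
- exact: grade_tin.
- exact: coprodM.
- by rewrite hadamard_tin.
Qed.

Lemma rcoprodM s t : grade 2 s -> grade 2 t ->
  rcoprod (hadamard s t) = hadamard (rcoprod s) (rcoprod t).
Proof.
apply: (tensor2_lift_hadamard (m := 1) (n := 2)) => *.
- exact: grade_tin.
- exact: grade_coprod.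
- by rewrite hadamard_tin.
- exact: coprodM.
Qed.

Hypothesis d_leibniz : graded_leibniz (@grade R M T) d.

Lemma coassoc_incl t : grade 2 t ->
  lcoprod (J t) - rcoprod (J t) = e * J t - J t * e - J (d t).
Proof.
move: t; apply: grade_eq => [c x y|c x y|[|x [|y []]] // _].
- exact: (linearP ((lcoprod \o J) \- (rcoprod \o J))).
- exact: (linearP ((e \*o J) \- (e \o* J) \- (J \o d))).
rewrite word2 (d_leibniz (i := 1)) ?expr1 ?mulN1r; last exact: grade_tin.
rewrite mulNr rmorphB !rmorphM /= !tensor_map_in !tensor2_liftE /= !coprod_incl.
rewrite /reduced_coprod /primitive mulrBl mulrBr mulrDl mulrDr !mulrA.
by rewrite !opprD !opprK !addrA (ACl (2*4*3*6*(1*5)))%AC /= subrr addr0.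
Qed.

Lemma coassoc_primitive a :
  lcoprod (primitive (incl a)) - rcoprod (primitive (incl a)) =
  e * J (d (tensor_in T a)) - J (d (tensor_in T a)) * e.
Proof.
rewrite /primitive !linearD /= !tensor2_liftE /= coprod_one coprod_incl.
rewrite /reduced_coprod /primitive mulrBl mulrBr mulrDl mulrDr !mulrA.
rewrite !opprD !opprK !addrA (ACl ((8*3)*(1*5)*(2*6)*(4*7)))%AC /=.
by rewrite !subrr !addr0.
Qed.

Lemma coassoc_reduced_coprod a :
  lcoprod (reduced_coprod a) - rcoprod (reduced_coprod a) =
  J (d (d (tensor_in T a))).
Proof.
set t := d (tensor_in T a); apply: (addIr (lcoprod (J t) - rcoprod (J t))).
rewrite addrACA -opprD -!linearD /reduced_coprod subrK coassoc_primitive.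
by rewrite (coassoc_incl (grade_d_in a)) [RHS]addrC subrK.
Qed.

Lemma coassoc_coprod x :
  lcoprod (coprod x) - rcoprod (coprod x) = J (d (d (tensor_in T (proj x)))).
Proof.
rewrite -coassoc_reduced_coprod /coprod; move: (reduced_coprod _) => q.
rewrite !linearD !linearZ_LR /= !tensor2_liftE /= !coprod_one mulrA.
by rewrite scalerN addrACA subrr add0r.
Qed.

Lemma square_zero_mul x y :
  d (d (tensor_in T (proj x))) = 0 -> d (d (tensor_in T (proj y))) = 0 ->
  d (d (tensor_in T (proj (x * y)))) = 0.
Proof.
have d2P z : d (d (tensor_in T (proj z))) = 0 <->
    lcoprod (coprod z) = rcoprod (coprod z).
  split=> [d2z|lr]; first by apply/subr0_eq; rewrite coassoc_coprod d2z linear0.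
  apply: (can_inj (tensor_mapK T U (aug_inclK aug))).
  by rewrite -coassoc_coprod lr subrr linear0.
move=> /d2P x_coassoc /d2P y_coassoc; apply/d2P; rewrite coprodM.
by rewrite lcoprodM ?rcoprodM ?x_coassoc ?y_coassoc //; apply: grade_coprod.
Qed.

End Multiplicativity.

End Coproduct.

Section Leibniz.
Variables (R : comNzRingType) (M : lmodType R) (T : tensor_model M).
Variable d : {linear T -> T}.
Hypotheses (d_degree : degree_one (@grade R M T) d)
  (d_leibniz : graded_leibniz (@grade R M T) d).

Lemma leibniz_one : d 1 = 0.
Proof.
have := d_leibniz 1 (grade_one T); rewrite expr0 !mulr1 mul1r => d1.
by apply: (addrI (d 1)); rewrite addr0.
Qed.

Lemma square_zero_tensor :
  (forall a, d (d (tensor_in T a)) = 0) -> forall u, d (d u) = 0.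
Proof.
move=> d2; apply: (tensor_eq (g := fun=> 0)) => [||w].
- exact: (linearP (d \o d)).
- by move=> c x y; rewrite scaler0 addr0.
elim: w => [|a w IH]; first by rewrite word_nil leibniz_one raddf0.
have da := d_degree (grade_tin T a).
rewrite word_cons (d_leibniz _ (grade_tin T a)) expr1 mulN1r mulNr raddfB /=.
rewrite (d_leibniz _ da) (d_leibniz _ (grade_tin T a)) d2 IH.
by rewrite sqrrN expr1n expr1 mul1r mul0r add0r mulr0 addr0 subrr.
Qed.

End Leibniz.

(** * Algebras carried by a subset *)

Definition scalar_map (R : comNzRingType) (A : lalgType R) (c : R^o) : A := c%:A.

Lemma scalar_map_linear (R : comNzRingType) (A : lalgType R) : linear (@scalar_map R A).
Proof. by move=> c x y; rewrite /scalar_map scalerDl scalerA. Qed.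

HB.instance Definition _ (R : comNzRingType) (A : lalgType R) :=
  GRing.isLinear.Build R R^o A _ (@scalar_map R A) (@scalar_map_linear R A).

Record alg_surjection (R : comNzRingType) (B : comAlgType R) (V : lmodType R)
    (f : B -> V) (S : V -> Prop) (mul : V -> V -> V) (one : V) : Prop := AlgSurjection {
  surj_in : forall x, S (f x);
  surj_onto : forall v, S v -> exists x, v = f x;
  surj_one : f 1 = one;
  surj_mul : {morph f : x y / x * y >-> mul x y} }.

Section AlgSurjection.
Variables (R : comNzRingType) (B : comAlgType R) (V : lmodType R) (f : {linear B -> V}).
Variables (S : V -> Prop) (mul : V -> V -> V) (one : V).
Hypothesis fP : alg_surjection f S mul one.

Lemma alg_surjection_com : com_algebra_on S mul one.
Proof.
have [fS onto f1 fM] := fP; split.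
- split=> [|c _ _ /onto[x ->] /onto[y ->]]; first by rewrite -(linear0 f).
  by rewrite -linearP.
- split=> [_ _ /onto[x ->] /onto[y ->]|c _ _ _ /onto[x ->] /onto[x' ->] /onto[y ->]
    |c _ _ _ /onto[x ->] /onto[y ->] /onto[y' ->]].
  + by rewrite -fM.
  + by rewrite -linearP -!fM mulrDl -scalerAl linearP.
  + by rewrite -linearP -!fM mulrDr -scalerAr linearP.
- by rewrite -f1.
- by move=> _ /onto[x ->]; rewrite -f1 -fM mul1r.
- by move=> _ _ /onto[x ->] /onto[y ->]; rewrite -!fM mulrC.
- by move=> _ _ _ /onto[x ->] /onto[y ->] /onto[z ->]; rewrite -!fM mulrA.
Qed.

Lemma alg_surjection_falling x n :
  falling mul one (f x) n = f (\prod_(i < n) (x - i%:R)).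
Proof.
rewrite /falling (big_morph f (surj_mul fP) (surj_one fP)); apply: eq_bigr => i _.
by rewrite -(surj_one fP) -raddfMn -raddfB.
Qed.

End AlgSurjection.

(** * Cup-one differential graded algebras on tensor algebras *)

Section CupOneDga.
Variables (R : comNzRingType) (A : comAlgType R) (M : lmodType R) (mu : M -> M -> M).
Variables (aug : augmentation A mu) (T : tensor_model M) (ops : cup_one_ops T).
Hypothesis opsP : tensor_cup_one mu ops.
Local Notation grade := (@grade R M T).
Local Notation tin := (tensor_in T).

Definition unitization (x : A) : R^o * T := (counit aug x, tin (aug_proj aug x)).

Lemma unitization_linear : linear unitization.
Proof. by move=> c x y; rewrite /unitization !linearP. Qed.

HB.instance Definition _ :=
  GRing.isLinear.Build R A (R^o * T)%type _ unitization unitization_linear.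

Lemma unitization_surjection : alg_surjection unitization (unitized grade)
  (unitized_mul ops) (unitized_one T).
Proof.
split=> [x|[r t] /grade1P[a /= ->]||x y].
- exact: grade_tin.
- exists (r%:A + aug_incl aug a).
  by rewrite /unitization counit_split aug_proj_split.
- by rewrite /unitization counit1 aug_proj1 linear0.
rewrite /unitization /unitized_mul counitM aug_projM /= !linearD !linearZ_LR /=.
by rewrite (cup11_in opsP).
Qed.

Lemma unitization_inj : injective unitization.
Proof.
move=> x y [epsxy tinxy]; rewrite [x](aug_split aug) [y](aug_split aug) epsxy.
by rewrite (tensor_in_inj tinxy).
Qed.

Lemma grade0_surjection : alg_surjection (@scalar_map R T) (grade 0) *%R 1.
Proof.
split=> [c|t /grade0P//||c c'].
- by apply: (submoduleZ (grade_submodule T 0)); apply: grade_one.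
- exact: (rmorph1 (GRing.in_alg T)).
- exact: (rmorphM (GRing.in_alg T)).
Qed.

Lemma scalar_map_tensor_inj : injective (@scalar_map R T).
Proof.
have gM : multilinear (fun w : seq M => if w is [::] then 1 : R^o else 0).
  by move=> [|a w] w' c a' b /=; rewrite scaler0 addr0.
apply: (can_inj (g := tensor_lift T gM)) => c.
by rewrite /scalar_map -(word_nil T) linearZ_LR /= tensor_lift_word [LHS]mulr1.
Qed.

Lemma cup11_bilinear_on : bilinear_on (grade 1) (grade 1) (grade 1) (cup11 ops).
Proof.
apply: bilinear_on_grade (cup11_bilinear opsP) _ => [[|a []] // [|b []] // _ _].
by rewrite !word1 (cup11_in opsP); apply: grade_tin.
Qed.

Lemma cup21_bilinear_on : bilinear_on (D2 grade) (grade 1) (grade 2) (cup21 ops).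
Proof.
rewrite D2E; apply: bilinear_on_grade (cup21_bilinear opsP) _.
move=> [|a [|b []]] // [|c []] // _ _; rewrite word1 word2 (cup21_in opsP).
by apply: (submoduleD (grade_submodule T 2)); apply: grade_tin2.
Qed.

Lemma circ_bilinear_on : bilinear_on (D2 grade) (D2 grade) (D2 grade) (circ ops).
Proof.
rewrite D2E; apply: bilinear_on_grade (circ_bilinear opsP) _.
move=> [|a [|b []]] // [|a' [|b' []]] // _ _.
by rewrite !word2 (circ_in opsP); apply: grade_tin2.
Qed.

Lemma tensor_cup_one_dga (d : {linear T -> T}) :
  degree_one grade d -> graded_leibniz grade d ->
  (forall a b, cup1_d_formula d ops (tin a) (tin b)) ->
  (forall u, d (d u) = 0) -> cup_one_dga grade d ops.
Proof.
move=> d_degree d_leibniz d_cup1 d2; split.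
- split=> //; [exact: tensor_graded|exact: linearP].
- exact: cup11_bilinear_on.
- exact: cup21_bilinear_on.
- exact: circ_bilinear_on.
- exact: alg_surjection_com unitization_surjection.
- move=> _ _ _ /grade1P[a ->] /grade1P[b ->] /grade1P[c ->].
  by rewrite (cup21_in opsP) !(cup11_in opsP) addrC.
- move=> _ _ _ _ /grade1P[a ->] /grade1P[b ->] /grade1P[a' ->] /grade1P[b' ->].
  by rewrite (circ_in opsP) !(cup11_in opsP).
- move=> a _ _ /grade0P[c ->]; rewrite linearZ_LR leibniz_one // scaler0.
  by rewrite (linear_map0 ((cup11_bilinear opsP).2 a)) mulr_algl mulr_algr subrr.
- by move=> _ _ /grade1P[a ->] /grade1P[b ->] _ _; apply: d_cup1.
Qed.

End CupOneDga.

(** * Binomial rings *)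

Definition binomial_ring (k : coef) (B : comNzRingType) : Prop :=
  match k with
  | CoefZ => (forall (a : B) n, (0 < n)%N -> a *+ n = 0 -> a = 0) /\
      (forall (a : B) n, exists b, b *+ n`! = \prod_(i < n) (a - i%:R))
  | CoefFp p _ => forall a : B, a ^+ p = a
  end.

Lemma Fp_prod_natr (p : nat) (B : comNzRingType) (G : 'F_p -> B) : prime p ->
  \prod_(x : 'F_p) G x = \prod_(i < p) G i%:R.
Proof.
move=> p_pr; rewrite (reindex (fun i : 'I_p => i%:R : 'F_p)) //.
exists (cast_ord (Fp_cast p_pr)) => [i _|x _]; last by rewrite natr_Zp.
by apply: val_inj; rewrite /= val_Fp_nat // modn_small.
Qed.

Lemma falling_Frobenius (p : nat) (B : comAlgType 'F_p) (a : B) : prime p ->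
  \prod_(i < p) (a - i%:R) = a ^+ p - a.
Proof.
move=> p_pr; have := congr1 (horner_alg a) (finField_genPoly 'F_p).
rewrite card_Fp // rmorphB rmorphXn /= rmorph_prod horner_algX => ->.
rewrite Fp_prod_natr //; apply: eq_bigr => i _.
by rewrite rmorphB /= horner_algX horner_algC scaler_nat.
Qed.

Lemma binomial_algebra_onP (k : coef) (B : comAlgType (coef_ring k))
    (V : lmodType (coef_ring k)) (f : {linear B -> V}) S mul one :
  alg_surjection f S mul one -> injective f -> binomial_ring k B ->
  binomial_algebra_on S mul one.
Proof.
move=> fP f_inj B_binomial; split; first exact: alg_surjection_com fP.
case: k B V f S mul one fP f_inj B_binomial => [|p p_pr] B V f S mul one fP f_inj.
  move=> [B_tf B_bin]; split=> _ n /(surj_onto fP)[x ->] n_gt0.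
    by rewrite -raddfMn -(raddf0 f) => /f_inj/(B_tf _ _ n_gt0) ->.
  have [b bE] := B_bin x n; exists (f b); split; first exact: surj_in fP b.
  by rewrite (alg_surjection_falling fP) -bE raddfMn.
move=> B_frob _ /(surj_onto fP)[x ->].
by rewrite (alg_surjection_falling fP) falling_Frobenius // B_frob subrr raddf0.
Qed.

Lemma coef_binomial_ring (k : coef) : binomial_ring k (coef_ring k).
Proof.
case: k => [|p p_pr] /=.
  split=> [a n n_gt0|a n].
    by move/eqP; rewrite mulrn_eq0 eqn0Ngt n_gt0 => /eqP.
  by have [b ->] := int_ffact_dvd a n; exists b; rewrite mulr_natr.
by move=> a; have := expf_card a; rewrite card_Fp.
Qed.

(** * The Newton basis of integer-valued polynomials *)

Section NewtonBasis.
Variable X : choiceType.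
Local Notation polyQ := {malg rat[{cmonom X}]}.

Definition newton (k : {cmonom X}) : polyQ := \prod_(x <- finsupp k) pzeta (k x) x.

Lemma pzeta0 (x : X) : pzeta 0 x = 1.
Proof. by rewrite /pzeta big_ord0 fact0 invr1 scale1r. Qed.

Lemma pzetaS n (x : X) :
  pvar x * pzeta n x = n.+1%:R *: pzeta n.+1 x + n%:R *: pzeta n x.
Proof.
rewrite /pzeta big_ord_recr factS natrM invfM /=.
set P := \prod_(i < n) _; set u : rat := n`!%:R^-1.
rewrite scalerA mulVKf ?pnatr_eq0 // [n%:R *: _]scalerA [n%:R * u]mulrC.
rewrite -[(u * _) *: P]scalerA [n%:R *: P]scaler_nat -[P *+ n]mulr_natr.
by rewrite -scalerDr -mulrDr subrK -scalerAr mulrC.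
Qed.

Lemma newtonEw (k : {cmonom X}) (E : {fset X}) : (finsupp k `<=` E)%fset ->
  newton k = \prod_(x <- E) pzeta (k x) x.
Proof.
move=> le_kE; rewrite [LHS](big_fset_incl _ le_kE) => //= x _.
by rewrite memNfinsupp => /eqP ->; rewrite pzeta0.
Qed.

Lemma newton1 : newton 1%M = 1.
Proof. by rewrite /newton mdom1 big_seq_fset0. Qed.

Lemma newtonX x (k : {cmonom X}) : pvar x * newton k =
  (k x).+1%:R *: newton (k * ucm x)%M + (k x)%:R *: newton k.
Proof.
pose E := (x |` finsupp k)%fset; pose P := \prod_(y <- (E `\ x)%fset) pzeta (k y) y.
have newtonE (j : {cmonom X}) : (finsupp j `<=` E)%fset ->
    (forall y, y != x -> j y = k y) -> newton j = pzeta (j x) x * P.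
  move=> le_jE jk; rewrite (newtonEw le_jE).
  have -> : P = \prod_(y <- (E `\ x)%fset) pzeta (j y) y.
    by apply: eq_big_seq => y; rewrite in_fsetD1 => /andP[/jk -> _].
  by apply: big_fsetD1; rewrite in_fset1U eqxx.
have -> : newton k = pzeta (k x) x * P by apply: newtonE; rewrite ?fsubsetUr.
have -> : newton (k * ucm x)%M = pzeta (k x).+1 x * P.
  rewrite newtonE; first by rewrite cmM cmUU addn1.
    by rewrite mdomD mdomU fsetUC.
  by move=> y yx; rewrite cmM cmU eq_sym (negPf yx) addn0.
have := pzetaS (k x) x; move: (pzeta _ x) (pzeta _ x) => a b ba.
by rewrite mulrA ba mulrDl !(scalerAl _ _ P).
Qed.

Local Notation newton_span := (lspan (fun p => exists k, p = newton k)).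

Lemma newton_spanX x p : newton_span p -> newton_span (pvar x * p).
Proof.
move: p; apply: lspan_sub => [|_ [k ->]].
  by apply: (submodule_preim (lspan_submodule _)) => c p q; rewrite mulrDr scalerAr.
rewrite newtonX; apply: (submoduleD (lspan_submodule _));
  apply: (submoduleZ (lspan_submodule _)); apply: lspan_gen.
- by exists (k * ucm x)%M.
- by exists k.
Qed.

Lemma cmonom_divK (k : {cmonom X}) x : x \in finsupp k ->
  k = (ucm x * divcm k (ucm x))%M.
Proof.
move=> xk; apply/eqP/cmP => y; rewrite cmM divcmE ucmE.
have [<-|_] := eqVneq x y; first by rewrite subnKC // lt0n cmE_neq0.
by rewrite add0n subn0.
Qed.

Lemma newton_span_monom (k : {cmonom X}) : newton_span << k >>.
Proof.
have [n] := ubnP (mdeg k); elim: n k => // n IH k; rewrite ltnS => deg_k.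
have [k1|k_neq1] := eqVneq k 1%M.
  by apply: lspan_gen; exists 1%M; rewrite newton1 k1.
have /fset0Pn[x xk] : finsupp k != fset0.
  by apply: contraNneq k_neq1 => k0; rewrite -mdeg_eq0 mdegE k0 big_seq_fset0.
have kE := cmonom_divK xk.
have -> : << k >> = pvar x * << divcm k (ucm x) >> :> polyQ.
  by rewrite {1}kE /pvar malgM_def fgmulUU mulr1.
by apply/newton_spanX/IH; apply: leq_trans deg_k; rewrite {2}kE mdegM mdegU.
Qed.

Lemma newton_spans q : newton_span q.
Proof.
apply: lspan_sub (lspan_submodule _) _ _ (malg_span q) => _ [k ->].
exact: newton_span_monom.
Qed.

Lemma peval_newton (l k : {cmonom X}) :
  peval (fun x => (l x)%:Z) (newton k) = \prod_(x <- finsupp k) 'C(l x, k x)%:R.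
Proof.
rewrite rmorph_prod; apply: eq_bigr => x _ /=; move: (k x) => n.
rewrite /pzeta /peval mmapZ -/(peval _ _) rmorph_prod /=.
apply: (canLR (mulKf _)); first by rewrite pnatr_eq0 -lt0n fact_gt0.
rewrite mulrC -natrM bin_ffact ffact_prod natr_prod.
have pevalE i : peval (fun x => (l x)%:Z) (pvar x - i%:R) = (l x)%:R - i%:R.
  by rewrite rmorphB rmorph_nat /= peval_var.
have [le_nl|lt_ln] := leqP n (l x).
  by apply: eq_bigr => i _; rewrite pevalE natrB // ltnW // (leq_trans _ le_nl).
rewrite (bigD1 (Ordinal lt_ln)) //= pevalE subrr mul0r.
by rewrite (bigD1 (Ordinal lt_ln)) //= subnn mul0r.
Qed.

Lemma peval_malg_lift f (K : choiceType) (b : K -> polyQ) (g : {malg rat[K]}) :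
  peval f (malg_lift b g) = \sum_(k <- msupp g) g@_k * peval f (b k).
Proof. by rewrite raddf_sum; apply: eq_bigr => k _; apply: mmapZ. Qed.

Lemma mdeg_ltn (k l : {cmonom X}) :
  (forall x, k x <= l x)%N -> k != l -> (mdeg k < mdeg l)%N.
Proof.
move=> le_kl; have -> : l = (k * divcm l k)%M.
  by apply/eqP/cmP => x; rewrite cmM divcmE subnKC.
rewrite mdegM -{1}[mdeg k]addn0 ltn_add2l lt0n mdeg_eq0.
by apply: contraNneq => ->; rewrite mulm1.
Qed.

(* Evaluation at the nonnegative points is unitriangular in the Newton basis. *)
Lemma newton_coef_int (g : {malg rat[{cmonom X}]}) :
  malg_lift newton g \in @int_valued X -> forall k, g@_k \is a Num.int.
Proof.
move=> /asboolP gint l; have [n] := ubnP (mdeg l).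
elim: n l => // n IH l; rewrite ltnS => deg_l.
have [|/mcoeff_outdom -> //] := boolP (l \in msupp g) => lg.
have := gint (fun x => (l x)%:Z).
rewrite peval_malg_lift (big_fsetD1 l lg) /= rpredDr.
  by rewrite (peval_newton l) big1 ?mulr1 // => x _; rewrite binn.
rewrite big_seq rpred_sum // => k; rewrite in_fsetD1 (peval_newton l) => /andP[kl _].
have [/allP kle|/allPn[x xk]] :=
    boolP (all (fun x => k x <= l x)%N (finsupp k)); last first.
  rewrite -ltnNge => lt_lk; rewrite (big_fsetD1 x xk) /= bin_small // mul0r mulr0.
  exact: rpred0.
apply: rpredM; last by apply: rpred_prod => x _; apply: rpred_nat.
apply/IH/(leq_trans _ deg_l)/mdeg_ltn => // x.
by have [/kle|] := boolP (x \in finsupp k); rewrite // memNfinsupp => /eqP ->.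
Qed.

Lemma malg_lift_newton_inj : injective (malg_lift newton).
Proof.
apply: raddf_inj => g g0; apply/malgP => k; rewrite mcoeff0; apply/eqP/negPn/negP => gk.
have : malg_lift newton ((2%:R * g@_k)^-1 *: g) \in @int_valued X.
  by rewrite linearZ_LR /= g0 [_ *: _]scaler0 rpred0.
by move/newton_coef_int/(_ k); rewrite mcoeffZ invfM mulfVK.
Qed.

End NewtonBasis.

Arguments newton {X} k.
Arguments malg_lift_newton_inj {X}.

Section IntegerNewtonBasis.
Variable X : choiceType.
Local Notation polyQ := {malg rat[{cmonom X}]}.

Definition zbasis (k : {cmonom X}) : IntZ X := \prod_(x <- finsupp k) zeta (k x) x.

Lemma intz_val_zbasis k : intz_val (zbasis k) = newton k.
Proof. exact: (rmorph_prod (\val : IntZ X -> polyQ)). Qed.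

Lemma intz_valZ (c : int) (q : IntZ X) : intz_val (c *: q) = c%:~R *: intz_val q.
Proof. by rewrite scaler_int; apply: (raddfMz (\val : IntZ X -> polyQ)). Qed.

Definition malg_intr (g : {malg int[{cmonom X}]}) : polyQ :=
  [malg k in msupp g => (g@_k)%:~R].

Lemma mcoeff_intr g k : (malg_intr g)@_k = (g@_k)%:~R.
Proof. by rewrite mcoeffE; case: ifPn => // /mcoeff_outdom ->. Qed.

Lemma malg_intr_surj (g : polyQ) : (forall k, g@_k \is a Num.int) ->
  exists h, malg_intr h = g.
Proof.
move=> gint; exists [malg k in msupp g => Num.floor g@_k]; apply/malgP => k.
rewrite mcoeff_intr mcoeffE; case: ifPn => [_|/mcoeff_outdom -> //].
exact/floorK/gint.
Qed.

Lemma intz_val_malg_lift g :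
  intz_val (malg_lift zbasis g) = malg_lift newton (malg_intr g).
Proof.
have le_msupp : (msupp (malg_intr g) `<=` msupp g)%fset.
  apply/fsubsetP => k; rewrite -!mcoeff_neq0 mcoeff_intr.
  by apply: contraNneq => ->.
rewrite (malg_liftEw _ le_msupp) [LHS](raddf_sum (\val : IntZ X -> polyQ)).
apply: eq_bigr => k _; rewrite mcoeff_intr -intz_val_zbasis.
exact: intz_valZ.
Qed.

Lemma malg_lift_zbasis_surj (q : IntZ X) : exists g, malg_lift zbasis g == q.
Proof.
have [g gq] := lspan_malg_lift (newton_spans (intz_val q)).
have [|h hg] := malg_intr_surj (g := g).
  by apply: newton_coef_int; rewrite gq; apply: valP.
by exists h; apply/eqP/val_inj; rewrite /= intz_val_malg_lift hg.
Qed.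

Lemma malg_lift_zbasis_inj : injective (malg_lift zbasis).
Proof.
move=> g h gh; apply/malgP => k; apply: (@intr_inj rat); rewrite -!mcoeff_intr.
by congr (_@_k); apply: malg_lift_newton_inj; rewrite -!intz_val_malg_lift gh.
Qed.

Definition zcoord (q : IntZ X) : {malg int[{cmonom X}]} :=
  xchoose (malg_lift_zbasis_surj q).

Lemma zcoordK : cancel zcoord (malg_lift zbasis).
Proof. by move=> q; apply/eqP/(xchooseP (malg_lift_zbasis_surj q)). Qed.

Lemma zcoord_linear : linear zcoord.
Proof.
by move=> c p q; apply: malg_lift_zbasis_inj; rewrite linearP /= !zcoordK.
Qed.

HB.instance Definition _ :=
  GRing.isLinear.Build int (IntZ X) {malg int[{cmonom X}]} _ zcoord zcoord_linear.

Lemma IntZ_ind (P : IntZ X -> Prop) : is_subring P ->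
  (forall n x, P (zeta n x)) -> forall q, P q.
Proof.
move=> subP Pzeta q; rewrite -(zcoordK q); apply: big_ind => [||k _].
- exact: is_subring0 subP.
- exact: is_subringD subP.
by apply: (is_subringMz subP); apply: (is_subring_prod subP).
Qed.

Lemma fact_zeta n (x : X) : zeta n x *+ n`! = \prod_(i < n) (varZ x - i%:R).
Proof.
have n_fact : n`!%:R != 0 :> rat by rewrite pnatr_eq0 -lt0n fact_gt0.
apply: val_inj; rewrite [LHS](raddfMn (\val : IntZ X -> polyQ)) /= /pzeta.
rewrite -scaler_nat scalerA mulfV // scale1r.
rewrite [RHS](rmorph_prod (\val : IntZ X -> polyQ)); apply: eq_bigr => i _.
rewrite [RHS](raddfB (\val : IntZ X -> polyQ)); congr (_ - _).
exact/esym/(rmorph_nat (\val : IntZ X -> polyQ)).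
Qed.

Lemma IntZ_mulrn_eq0 (q : IntZ X) n : (0 < n)%N -> q *+ n = 0 -> q = 0.
Proof.
move=> n_gt0; apply: (retract_mulrn_eq0 zcoordK) => g /malgP gn.
apply/malgP => k; have := gn k; rewrite mcoeffMn !mcoeff0.
by move/eqP; rewrite mulrn_eq0 eqn0Ngt n_gt0 => /eqP.
Qed.

Lemma IntZ_binomial (q : IntZ X) n :
  exists b : IntZ X, b *+ n`! = \prod_(i < n) (q - i%:R).
Proof.
have n_fact : n`!%:R != 0 :> rat by rewrite pnatr_eq0 -lt0n fact_gt0.
pose P := \prod_(i < n) (q - i%:R).
have bP : n`!%:R^-1 *: intz_val P \in @int_valued X.
  apply/asboolP => f; have /asboolP/(_ f)/intrP[z qz] := valP q.
  have -> : peval f (n`!%:R^-1 *: intz_val P) = n`!%:R^-1 * peval f (intz_val P).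
    exact: mmapZ.
  have -> : peval f (intz_val P) = (\prod_(i < n) (z - i%:R))%:~R.
    pose ev : {rmorphism IntZ X -> rat} := peval f \o \val.
    rewrite [LHS](rmorph_prod ev) rmorph_prod; apply: eq_bigr => i _.
    by rewrite rmorphB rmorph_nat /= [peval f _]qz rmorphB /= rmorph_nat.
  have [m ->] := int_ffact_dvd z n.
  by rewrite rmorphM /= rmorph_nat mulrCA mulVf ?mulr1 ?intr_int.
exists (MkIntZ bP); apply: val_inj.
rewrite [LHS](raddfMn (\val : IntZ X -> polyQ)) /= -scaler_nat scalerA.
by rewrite mulfV ?scale1r.
Qed.

End IntegerNewtonBasis.

Arguments zbasis {X} k.
Arguments zcoord {X} q.

(** * Integer-valued polynomials over Z and over F_p *)

Section ConstantTerm.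
Variable X : choiceType.

Definition const_term (q : IntZ X) : int := Num.floor (intz_val q)@_1%M.

Lemma const_termE q : (const_term q)%:~R = (intz_val q)@_1%M.
Proof. exact/floorK/const_int. Qed.

Lemma const_term_zmod_morphism : zmod_morphism const_term.
Proof.
by move=> p q; apply: (@intr_inj rat); rewrite rmorphB /= !const_termE /= mcoeffB.
Qed.

HB.instance Definition _ :=
  GRing.isZmodMorphism.Build (IntZ X) int const_term const_term_zmod_morphism.

Lemma const_term_monoid_morphism : monoid_morphism const_term.
Proof.
split=> [|p q]; apply: (@intr_inj rat); first by rewrite const_termE /= rmorph1.
by rewrite rmorphM /= !const_termE /= rmorphM.
Qed.

HB.instance Definition _ :=
  GRing.isMonoidMorphism.Build (IntZ X) int const_term const_term_monoid_morphism.

Lemma const_term_var x : const_term (varZ x) = 0.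
Proof. by apply: (@intr_inj rat); rewrite const_termE mcoeffU1 cm1_eq1. Qed.

Lemma const_term_zeta n (x : X) : (0 < n)%N -> const_term (zeta n x) = 0.
Proof.
move=> n_gt0; have : const_term (zeta n x *+ n`!) = 0.
  rewrite fact_zeta rmorph_prod (bigD1 (Ordinal n_gt0)) //= subr0 const_term_var.
  exact: mul0r.
by rewrite raddfMn /= => /eqP; rewrite mulrn_eq0 eqn0Ngt fact_gt0 => /eqP.
Qed.

End ConstantTerm.

Lemma gen_ideal_ker (A B : nzRingType) (G : A -> Prop) (f : {rmorphism A -> B}) :
  (forall g, G g -> f g = 0) -> forall x, gen_ideal G x -> f x = 0.
Proof.
move=> fG x /(_ (fun y => f y = 0)); apply=> //; split=> [|y z fy fz|u y v fy].
- exact: rmorph0.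
- by rewrite rmorphB fy fz subrr.
- by rewrite !rmorphM fy mulr0 mul0r.
Qed.

Lemma prime_dvd_fact p n : prime p -> (p %| n`!)%N -> (p <= n)%N.
Proof.
move=> p_pr; elim: n => [|n IH]; first by rewrite dvdn1 => /eqP p1; rewrite p1 in p_pr.
by rewrite factS Euclid_dvdM // => /orP[/dvdn_leq ->|/IH/leqW].
Qed.

Lemma coef_ring_int (k : coef) (c : coef_ring k) : exists z : int, c = z%:~R.
Proof.
case: k c => [|p p_pr] c /=; first by exists c; rewrite intz.
by exists (c : nat)%:Z; rewrite -pmulrn natr_Zp.
Qed.

Lemma coef_scalable (k : coef) (U V : lmodType (coef_ring k)) (f : {additive U -> V}) :
  scalable f.
Proof. by move=> c u; have [z ->] := coef_ring_int c; rewrite !scaler_int raddfMz. Qed.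

Section ProjFp.
Variables (p : nat) (p_pr : prime p) (X : choiceType).

Lemma projFp_zmod_morphism : zmod_morphism (@projFp p p_pr X).
Proof. exact: (rprojB (zeta_rel_proper p_pr (X := X))). Qed.

HB.instance Definition _ := GRing.isZmodMorphism.Build (IntZ X) (IntFp p_pr X)
  (@projFp p p_pr X) projFp_zmod_morphism.

Lemma projFp_monoid_morphism : monoid_morphism (@projFp p p_pr X).
Proof. exact: (rproj_monoid_morphism (zeta_rel_proper p_pr (X := X))). Qed.

HB.instance Definition _ := GRing.isMonoidMorphism.Build (IntZ X) (IntFp p_pr X)
  (@projFp p p_pr X) projFp_monoid_morphism.

Lemma projFp_eq0 q : projFp p_pr q = 0 :> IntFp p_pr X <-> gen_ideal (@zeta_rel p X) q.
Proof.
rewrite -(rmorph0 (@projFp p p_pr X)) -[q in X in _ <-> X]subr0.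
exact: (rproj_eq (zeta_rel_proper p_pr (X := X))).
Qed.

Lemma projFp_zeta n x : (p <= n)%N -> projFp p_pr (zeta n x) = 0 :> IntFp p_pr X.
Proof.
by move=> le_pn; apply/projFp_eq0; apply: gen_ideal_gen; right; exists x, n.
Qed.

Lemma projFp_const_term q :
  projFp p_pr q = 0 :> IntFp p_pr X -> (const_term q)%:~R = 0 :> 'F_p.
Proof.
move=> /projFp_eq0; apply: (gen_ideal_ker (f := intr \o @const_term X)) => {q} q.
move=> [->|[x [n [le_pn ->]]]] /=; last first.
  by rewrite const_term_zeta // (leq_trans (prime_gt0 p_pr)).
by rewrite !rmorph_nat (pcharf0 (pchar_Fp p_pr)).
Qed.

End ProjFp.

Section IntR.
Variables (k : coef) (X : choiceType).
Local Notation R := (coef_ring k).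
Local Notation A := (IntR k X).

Definition IntR_proj : {rmorphism IntZ X -> A} :=
  match k return {rmorphism IntZ X -> IntR k X} with
  | CoefZ => idfun
  | CoefFp p p_pr => @projFp p p_pr X
  end.

Definition IntR_repr : A -> IntZ X :=
  match k return IntR k X -> IntZ X with
  | CoefZ => id
  | CoefFp p p_pr => @rrepr _ _ (zeta_rel_proper p_pr (X := X))
  end.

Lemma IntR_reprK : cancel IntR_repr IntR_proj.
Proof.
by rewrite /IntR_repr /IntR_proj; case: k => [//|p p_pr]; apply: rreprK.
Qed.

Lemma IntR_proj_const_term q : IntR_proj q = 0 -> (const_term q)%:~R = 0 :> R.
Proof.
rewrite /IntR_proj; case: k => [/= ->|p p_pr]; first by rewrite rmorph0.
exact: projFp_const_term.
Qed.

Lemma IntR_proj_var x : IntR_proj (varZ x) = varR k x.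
Proof. by rewrite /IntR_proj; case: k. Qed.

Definition IntR_counit (a : A) : R := (const_term (IntR_repr a))%:~R.

Lemma IntR_counitE q : IntR_counit (IntR_proj q) = (const_term q)%:~R.
Proof.
apply/subr0_eq; rewrite -rmorphB -rmorphB; apply: IntR_proj_const_term.
by rewrite rmorphB IntR_reprK subrr.
Qed.

Lemma IntR_counit_zmod_morphism : zmod_morphism IntR_counit.
Proof.
move=> a b; rewrite -[a]IntR_reprK -[b]IntR_reprK -rmorphB !IntR_counitE.
by rewrite rmorphB rmorphB.
Qed.

HB.instance Definition _ :=
  GRing.isZmodMorphism.Build A R^o IntR_counit IntR_counit_zmod_morphism.
HB.instance Definition _ := GRing.isScalable.Build R A R^o *:%R IntR_counit
  (coef_scalable (IntR_counit : {additive A -> R^o})).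

Lemma IntR_counit1 : IntR_counit 1 = 1.
Proof. by rewrite -(rmorph1 IntR_proj) IntR_counitE rmorph1. Qed.

Lemma const_term_eq0 (q : IntZ X) : const_term q = 0 <-> (intz_val q)@_1%M = 0.
Proof. by rewrite -const_termE; split=> [->|q0] //; apply: (@intr_inj rat). Qed.

Lemma zero_constP a : reflect (IntR_counit a = 0) (a \in @zero_constb k X).
Proof.
apply: (iffP (asboolP _)) => [a0|].
  have [q q0 ->] : exists2 q, const_term q = 0 & a = IntR_proj q.
    rewrite /IntR_proj; case: k a a0 => [|p p_pr] a /=.
      by move/const_term_eq0; exists a.
    by case=> q /const_term_eq0; exists q.
  by rewrite IntR_counitE q0 rmorph0.
rewrite -[a]IntR_reprK IntR_counitE; move: (IntR_repr a) => q.
rewrite /IntR_proj; case: k => [|p p_pr] /= q0.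
  by apply/const_term_eq0; rewrite -[LHS]intz.
exists (q - (const_term q)%:~R).
  by apply/const_term_eq0; rewrite rmorphB rmorph_int /= intz subrr.
by rewrite rmorphB rmorph_int -scaler_int q0 scale0r subr0.
Qed.

Lemma zero_const_sub_counit a : a - (IntR_counit a)%:A \in @zero_constb k X.
Proof.
apply/zero_constP; rewrite linearB linearZ_LR /= IntR_counit1.
by rewrite [_ *: _]mulr1 subrr.
Qed.

Definition mIntR_proj (a : A) : mIntR k X := MkMIntR (zero_const_sub_counit a).

Lemma mIntR_proj_zmod_morphism : zmod_morphism mIntR_proj.
Proof.
move=> a b; apply: val_inj; rewrite /= linearB scalerBl.
by rewrite !opprD addrACA.
Qed.

HB.instance Definition _ :=
  GRing.isZmodMorphism.Build A (mIntR k X) mIntR_proj mIntR_proj_zmod_morphism.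
HB.instance Definition _ := GRing.isScalable.Build R A (mIntR k X) *:%R mIntR_proj
  (coef_scalable (mIntR_proj : {additive A -> mIntR k X})).

Lemma mIntR_valK : cancel (\val : mIntR k X -> A) mIntR_proj.
Proof.
move=> a; apply: val_inj => /=.
by have /zero_constP -> := valP a; rewrite scale0r subr0.
Qed.

Definition IntR_augmentation : augmentation A (@m_mul k X).
Proof.
refine (@Augmentation _ A _ _ IntR_counit (\val : mIntR k X -> A) mIntR_proj _ _ _ _ _).
- exact: IntR_counit1.
- by move=> a; have /zero_constP := valP a.
- exact: mIntR_valK.
- by move=> x; rewrite /= addrC subrK.
- by [].
Defined.

Lemma aug_proj_varR x : aug_proj IntR_augmentation (varR k x) = m_var k x.
Proof. exact: (mIntR_valK (m_var k x)). Qed.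

Lemma IntR_fact_zeta n x :
  IntR_proj (zeta n x) *+ n`! = \prod_(i < n) (varR k x - i%:R).
Proof.
rewrite -rmorphMn fact_zeta rmorph_prod; apply: eq_bigr => i _.
by rewrite rmorphB rmorph_nat /= IntR_proj_var.
Qed.

Lemma IntR_proj_zeta_eq0_or n x :
  IntR_proj (zeta n x) = 0 \/ n`!%:R != 0 :> R.
Proof.
rewrite /IntR_proj; case: k => [|p p_pr] /=.
  by right; rewrite pnatr_eq0 -lt0n fact_gt0.
have [le_pn|lt_np] := leqP p n; first by left; apply: projFp_zeta.
right; rewrite -(dvdn_pcharf (pchar_Fp p_pr)).
by apply: contraL lt_np => /(prime_dvd_fact p_pr); rewrite leqNgt.
Qed.

Lemma IntR_ind (P : A -> Prop) : is_subring P ->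
  (forall a n, n%:R != 0 :> R -> P (a *+ n) -> P a) ->
  (forall x, P (varR k x)) -> forall a, P a.
Proof.
move=> subP Pdiv Pvar a; rewrite -[a]IntR_reprK; move: (IntR_repr a).
apply: IntZ_ind => [|n x].
  split=> [|q r Pq Pr|q r Pq Pr].
  - by rewrite rmorph1; apply: is_subring1.
  - by rewrite rmorphB; apply: is_subringB.
  - by rewrite rmorphM; apply: is_subringM.
have [->|n_fact] := IntR_proj_zeta_eq0_or n x; first exact: is_subring0.
apply: (Pdiv _ _ n_fact); rewrite IntR_fact_zeta; apply: (is_subring_prod subP) => i.
exact: (is_subringB subP (Pvar x) (is_subringMn subP i (is_subring1 subP))).
Qed.

End IntR.

Lemma IntFp_Frobenius (p : nat) (p_pr : prime p) (X : choiceType)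
    (a : IntR (CoefFp p_pr) X) : a ^+ p = a.
Proof.
have charA : p \in [pchar (IntR (CoefFp p_pr) X)] by rewrite pchar_lalg pchar_Fp.
have frob := pFrobenius_autE charA.
move: a; apply: IntR_ind => [|a n n_neq0|x].
- split=> [|a b fa fb|a b fa fb]; first exact: expr1n.
    by rewrite -frob rmorphB /= !frob fa fb.
  by rewrite exprMn fa fb.
- rewrite -frob rmorphMn /= frob => /eqP; rewrite -subr_eq0 -mulrnBl -scaler_nat.
  by rewrite scaler_eq0 (negPf n_neq0) subr_eq0 => /eqP.
apply/subr0_eq; rewrite -falling_Frobenius //.
apply: etrans (esym (IntR_fact_zeta (CoefFp p_pr) p x)) _.
by rewrite /= projFp_zeta // mul0rn.
Qed.

Lemma IntR_binomial_ring (k : coef) (X : choiceType) : binomial_ring k (IntR k X).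
Proof.
case: k => [|p p_pr] /=; last exact: IntFp_Frobenius.
by split=> [q n|q n]; [apply: IntZ_mulrn_eq0|apply: IntZ_binomial].
Qed.

Lemma tensor_mIntR_mulrn_eq0 (k : coef) (X : choiceType)
    (T : tensor_model (mIntR k X)) n :
  n%:R != 0 :> coef_ring k -> forall t : T, t *+ n = 0 -> t = 0.
Proof.
case: k T => [|p p_pr] T /= n_neq0.
  have fL : linear (fun a : mIntR CoefZ X => zcoord (m_val a : IntZ X)).
    by move=> c a b; apply: (zcoord_linear c (m_val a) (m_val b)).
  have gL : linear (fun g : {malg (coef_ring CoefZ)[{cmonom X}]} =>
      mIntR_proj (malg_lift zbasis g : IntR CoefZ X)).
    move=> c g h; apply: etrans (linearP (@mIntR_proj CoefZ X) c _ _).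
    by congr (mIntR_proj _); apply: malg_lift_linear.
  apply: (tensor_mulrn_eq0 fL gL) => [a|z]; first by rewrite /= zcoordK mIntR_valK.
  by move/eqP; rewrite -mulr_natr mulf_eq0 (negPf n_neq0) orbF => /eqP.
by move=> t /eqP; rewrite -scaler_nat scaler_eq0 (negPf n_neq0) => /eqP.
Qed.

Lemma tensor_alg_cup_one (R : comNzRingType) (M : lmodType R) (mu : M -> M -> M) :
  (forall b, linear (mu^~ b)) -> (forall a, linear (mu a)) ->
  tensor_cup_one (T := tensor_alg_model M) mu
    (CupOneOps (tcup11 mu) (tcup21 mu) (tcirc mu)).
Proof.
move=> mu_l mu_r; split; [exact: tcup11E|exact: tcup21E|exact: tcircE| | |].
- by split; [apply: tcup11_linearl|apply: tcup11_linearr].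
- by split; [apply: tcup21_linearl|apply: tcup21_linearr].
- by split; [apply: tcirc_linearl|apply: tcirc_linearr].
Qed.

Section CupOneDifferential.
Variables (k : coef) (X : choiceType) (T : tensor_model (mIntR k X)).
Variables (ops : cup_one_ops T) (d : {linear T -> T}).
Hypothesis opsP : tensor_cup_one (@m_mul k X) ops.
Local Notation aug := (IntR_augmentation k X).

Lemma square_zero_of_vars :
  degree_one (@grade _ _ T) d -> graded_leibniz (@grade _ _ T) d ->
  (forall a b, cup1_d_formula d ops (tensor_in T a) (tensor_in T b)) ->
  (forall x, d (d (tensor_in T (m_var k x))) = 0) -> forall u, d (d u) = 0.
Proof.
move=> d_degree d_leibniz d_cup1 d2_var; apply: square_zero_tensor => // a.
rewrite -(aug_inclK aug a).
pose P x := d (d (tensor_in T (aug_proj aug x))) = 0.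
apply: (IntR_ind (P := P)) => {a} [|a n n_neq0|x].
- split=> [|a b Pa Pb|a b Pa Pb].
  + by rewrite /P aug_proj1 !linear0.
  + by rewrite /P !linearB Pa Pb subrr.
  exact: (square_zero_mul (tensor_alg_model _) opsP d_degree d_cup1 d_leibniz).
- by rewrite /P !raddfMn; apply: tensor_mIntR_mulrn_eq0.
by rewrite /P aug_proj_varR.
Qed.

Lemma tensor_binomial_cup_one_dga :
  cup_one_dga (@grade _ _ T) d ops ->
  binomial_cup_one_dga (@grade _ _ T) d ops.
Proof.
move=> dga_d; split=> //.
  apply: (binomial_algebra_onP (grade0_surjection T)).
    exact: scalar_map_tensor_inj.
  exact: coef_binomial_ring.
apply: (binomial_algebra_onP (unitization_surjection aug opsP)).
  exact: unitization_inj.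
exact: IntR_binomial_ring.
Qed.

End CupOneDifferential.

Theorem theorem1p1 (k : coef) (X : choiceType)
    (d : {linear freeT k X -> freeT k X}) :
  degree_one (@freeT_grade k X) d ->
  (forall a b : freeT k X, freeT_grade 1%N a -> freeT_grade 1%N b ->
     cup1_d_formula d (freeT_ops k X) a b) ->
  graded_leibniz (@freeT_grade k X) d ->
  ((forall x : X, d (d (freeT_var k x)) = 0) <->
   (forall u : freeT k X, d (d u) = 0)) /\
  ((forall u : freeT k X, d (d u) = 0) ->
     binomial_cup_one_dga (@freeT_grade k X) d (freeT_ops k X)).
Proof.
move=> d_degree d_cup1 d_leibniz.
pose T := tensor_alg_model (mIntR k X).
have opsP := tensor_alg_cup_one (@m_mul_linearl k X) (@m_mul_linearr k X).
have d_cup1_in a b : cup1_d_formula d (freeT_ops k X) (tin a) (tin b).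
  by apply: d_cup1; apply: (grade_tin T).
split; [split=> [d2_var|//]|move=> d2].
  exact: (square_zero_of_vars (T := T) opsP d_degree d_leibniz d_cup1_in d2_var).
apply: (tensor_binomial_cup_one_dga (T := T) opsP).
exact: (tensor_cup_one_dga (T := T) (IntR_augmentation k X) opsP
  d_degree d_leibniz d_cup1_in d2).
Qed.
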